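(* Let $s_0,s_1,s_{0,\mathrm{app}},s_{1,\mathrm{app}}\in H^1(-r,r)$ be real-valued, where $r>0$. Let $k_{\max}>\pi$, let $d_0=\Gamma(s_0)$, $d_{0,\mathrm{app}}=\Gamma(s_{0,\mathrm{app}})$ be defined on $(0,2k_{\max})$, and let $d_1=\Gamma(s_1)$, $d_{1,\mathrm{app}}=\Gamma(s_{1,\mathrm{app}})$ be defined on $\left(\pi,k_{\max}+\sqrt{k_{\max}^2-\pi^2}\right)$. Assume that there exists $M>0$ such that $\|s_i\|_{H^1(-r,r)}\le M$ and $\|s_{i,\mathrm{app}}\|_{H^1(-r,r)}\le M$ for $i=0,1$. Then for every $0<\varepsilon<1$ there exists a constant $\xi_{k_{\max}}$, depending on $r,M,\varepsilon$ (and, as the subscript indicates, on $k_{\max}$), such that $$\|s_0-s_{0,\mathrm{app}}\|_{L^2(-r,r)}^2\le\frac4\pi\|d_0-d_{0,\mathrm{app}}\|_{\mathrm H}^2+\frac{2\pi}{k_{\max}^2}M^2,$$ $$\|s_1-s_{1,\mathrm{app}}\|_{L^2(-r,r)}^2\le\xi_{k_{\max}}\|d_1-d_{1,\mathrm{app}}\|_{\mathrm H}^{2-2\varepsilon}+\frac4\pi\|d_1-d_{1,\mathrm{app}}\|_{\mathrm H}^2+\frac{8\pi}{\left(k_{\max}+\sqrt{k_{\max}^2-\pi^2}\right)^2}M^2 .$$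
   Context: Functions on $(-r,r)$ are extended by $0$ to $\mathbb R$, and $\Gamma(f)(\omega)=\frac{i}{2\omega}\int_{\mathbb R} f(z)e^{i\omega z}\,dz$ for $\omega>0$. For a function $v$ defined on an interval $I\subset(0,+\infty)$, $\|v\|_{\mathrm H}^2=\int_I\omega^2|v(\omega)|^2\,d\omega$; here $I=(0,2k_{\max})$ for $d_0,d_{0,\mathrm{app}}$ and $I=\left(\pi,k_{\max}+\sqrt{k_{\max}^2-\pi^2}\right)$ for $d_1,d_{1,\mathrm{app}}$.
   Formalization: The first estimate is proved only when s_0 - s_{0,app}, extended by 0, lies in H^1(R) (equal boundary values at ±r); without this it fails, e.g. for s_0 = c = -s_{0,app}, c = M/sqrt(2r), r = 1/π, k_max = 5. *)

(* Defs.v *)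
From HB Require Import structures.
From mathcomp Require Import all_boot all_order all_algebra.
From mathcomp Require Import complex.
From mathcomp Require Import all_classical all_reals all_analysis.

Set Implicit Arguments.
Unset Strict Implicit.
Unset Printing Implicit Defensive.

Import Order.TTheory GRing.Theory Num.Theory.
Import numFieldNormedType.Exports.

Local Open Scope classical_set_scope.
Local Open Scope complex_scope.
Local Open Scope ring_scope.

Section Sobolev.
Context {R : realType}.
Local Notation mu := (@lebesgue_measure R).

(* A function on D is represented by a total function of which only the values
   on D matter: [f \_ D] is its extension by 0. *)
Definition in_L2 (D : set R) (f : R -> R) : Prop := f \_ D \in Lfun mu 2%:E.

(* [fine] loses nothing when [in_L2 D f]. *)
Definition L2norm (D : set R) (f : R -> R) : R :=
  fine ('N[mu]_(2%:E)[EFin \o (f \_ D)])%E.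

(* C^1 functions with compact support in D; these give the same weak
   derivatives as smooth ones. *)
Definition test_function (D : set R) (phi : R -> R) : Prop :=
  [/\ forall x, derivable phi x 1,
      continuous (derive1 phi),
      compact (closure [set x | phi x != 0]) &
      closure [set x | phi x != 0] `<=` D].

Definition weak_derivative (D : set R) (f g : R -> R) : Prop :=
  forall phi, test_function D phi ->
    \int[mu]_(x in D) (f x * derive1 phi x) = - \int[mu]_(x in D) (g x * phi x).

Definition in_H1 (D : set R) (f : R -> R) : Prop :=
  in_L2 D f /\ exists g, in_L2 D g /\ weak_derivative D f g.

(* The weak derivative is unique almost everywhere on an open D, so [H1norm]
   does not depend on the choice made here. *)
Definition weak_deriv (D : set R) (f : R -> R) : R -> R :=
  xget (cst 0) [set g | in_L2 D g /\ weak_derivative D f g].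

Definition H1norm (D : set R) (f : R -> R) : R :=
  Num.sqrt (L2norm D f ^+ 2 + L2norm D (weak_deriv D f) ^+ 2).

End Sobolev.

Section Gamma.
Context {R : realType}.
Local Notation mu := (@lebesgue_measure R).

Definition expi (t : R) : R[i] := cos t +i* sin t.

Definition cintegral (g : R -> R[i]) : R[i] :=
  (\int[mu]_z complex.Re (g z)) +i* (\int[mu]_z complex.Im (g z)).

Definition Gamma (f : R -> R) (w : R) : R[i] :=
  (0 +i* 1) / (2 * w)%:C * cintegral (fun z => (f z)%:C * expi (w * z)).

(* The integral is finite for v = Gamma f with f integrable and J bounded:
   there w^2 |v w|^2 is at most ||f||_{L^1}^2 / 4. *)
Definition Hnorm (J : set R) (v : R -> R[i]) : R :=
  Num.sqrt (\int[mu]_(w in J) (w ^+ 2 * Normc.normc (v w) ^+ 2)).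

End Gamma.

(* Main.v *)
Require Import Defs.
From HB Require Import structures.
From mathcomp Require Import all_boot all_order all_algebra.
From mathcomp Require Import complex.
From mathcomp Require Import all_classical all_reals all_analysis.
From mathcomp Require Import measurable_realfun ring lra.

(** Let [F] be the extension by zero of a difference [s - s_app], [F^] its Fourier
    transform, and [h] the difference of the weak derivatives, so that the square
    norms of [F] and [h] are at most 4 M^2.  As w^2 |Gamma F|^2 = |F^|^2 / 4, the
    number 4 ||.||_H^2 is the energy of [F^] in the band of frequencies.

    Everything rests on an exponentially damped form of Plancherel's theorem: the
    integral of e^{-aw} |F^(w)|^2 over w > 0 is the Poisson form, the double integral
    of F(x) F(y) a / (a^2 + (x-y)^2) ([poisson_energy]).  This form is at most
    pi ||F||^2 ([poisson_form_le]); and since a weak derivative in L^2 makes [F]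
    Hoelder continuous of exponent 1/2 away from jumps ([weak_derivative_holder]), it
    is at least kappa ||F||^2 - O(sqrt a), where kappa is the mass of the kernel in a
    window on which [F] has no jump ([poisson_form_ge]).

    First estimate.  If [F] belongs to H^1 of the line, then |w F^(w)| = |h^(w)|
    ([fcos_weak_derivative]).  With W = 2 kmax, the energy of [F^] above [W] is
    therefore at most pi ||h||^2 / W^2 <= pi M^2 / kmax^2.  The window may exceed the
    support of [F], so kappa tends to pi with a -> 0, and
    pi ||F||^2 <= 4 ||.||_H^2 + pi M^2 / kmax^2 ([energy_estimate]).  The claim
    follows because 1 <= 2 pi.

    Second estimate.  Here [F] may jump at the end points and no such bound on the
    tail is available, but the constant xi may depend on everything except the
    functions.  If ||F||^2 <= delta = 8 pi M^2 / K1^2, the last term suffices.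
    Otherwise ||.||_H is at least a constant c > 0 ([band_energy_lower_bound]), and
    xi = 4 M^2 / c^(2 - 2 eps) works because ||F||^2 <= 4 M^2.  The constant c comes
    from quantitative unique continuation.  When the energy of [F^] in the band is
    small, so are all derivatives of [F^] inside the band ([controlled_polycos]);
    since [F] has bounded support, the Taylor series of [F^] then makes it small on any
    bounded set of frequencies ([fcos_continuation]).  But for a suitable fixed
    damping the Poisson form is at least a positive multiple of delta, so [F^] cannot be
    small on a long interval [0, N]. *)

Set Implicit Arguments.
Unset Strict Implicit.
Unset Printing Implicit Defensive.

Import Order.TTheory GRing.Theory Num.Theory.
Import numFieldNormedType.Exports.

Local Open Scope classical_set_scope.
Local Open Scope ring_scope.

(** * Real-valued integrals and Fubini's theorem *)

Notation integ f := ((@lebesgue_measure _).-integrable setT (EFin \o f)).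

Section RealIntegral.
Context {R : realType}.
Local Notation mu := (@lebesgue_measure R).
Implicit Types f g h : R -> R.

Lemma integ_measurable f : integ f -> measurable_fun setT f.
Proof. by move=> /measurable_int /measurable_EFinP. Qed.

Lemma integ_le f g : measurable_fun setT f -> integ g ->
  (forall x, `|f x| <= g x) -> integ f.
Proof.
move=> mf ig fg; apply: (le_integrable _ _ _ ig) => //.
  exact/measurable_EFinP.
by move=> x _ /=; rewrite lee_fin (le_trans (fg x))// ler_norm.
Qed.

Lemma integ_norm f : integ f -> integ (fun x => `|f x|).
Proof. by move=> fi; apply: integrable_norm. Qed.

Lemma integD f g : integ f -> integ g -> integ (fun x => f x + g x).
Proof. by move=> fi gi; have := integrableD measurableT fi gi. Qed.

Lemma integB f g : integ f -> integ g -> integ (fun x => f x - g x).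
Proof. by move=> fi gi; have := integrableB measurableT fi gi. Qed.

Lemma integZ c f : integ f -> integ (fun x => c * f x).
Proof. by move=> fi; have := integrableZl measurableT c fi. Qed.

Lemma integM c f g : integ f -> measurable_fun setT g ->
  (forall x, `|g x| <= c) -> integ (fun x => f x * g x).
Proof.
move=> fi mg gc; apply: (@integ_le _ (fun x => c * `|f x|)).
- exact: measurable_funM (integ_measurable fi) mg.
- exact/integZ/integ_norm.
- by move=> x; rewrite normrM mulrC ler_wpM2r.
Qed.

Lemma RintD f g : integ f -> integ g ->
  \int[mu]_x (f x + g x) = \int[mu]_x f x + \int[mu]_x g x.
Proof. by move=> fi gi; exact: RintegralD. Qed.

Lemma RintB f g : integ f -> integ g ->
  \int[mu]_x (f x - g x) = \int[mu]_x f x - \int[mu]_x g x.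
Proof. by move=> fi gi; exact: RintegralB. Qed.

Lemma RintZ c f : integ f ->
  \int[mu]_x (c * f x) = c * \int[mu]_x f x.
Proof. by move=> fi; exact: RintegralZl. Qed.

Lemma Rint_le f g : integ f -> integ g -> (forall x, f x <= g x) ->
  \int[mu]_x f x <= \int[mu]_x g x.
Proof. by move=> fi gi fg; apply: le_Rintegral => // x _. Qed.

Lemma Rint_eq f g : (forall x, f x = g x) ->
  \int[mu]_x f x = \int[mu]_x g x.
Proof. by move=> fg; apply: eq_Rintegral => x _. Qed.

Lemma Rint_ge0 f : (forall x, 0 <= f x) -> 0 <= \int[mu]_x f x.
Proof. by move=> f0; apply: Rintegral_ge0. Qed.

(** The exceptional set is an explicit measurable null set, so that one set can
    serve for both variables of an iterated integral. *)
Lemma Rint_le_off (N : set (measurableTypeR R)) f g : measurable N -> mu N = 0%E ->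
  integ f -> integ g -> (forall x, ~ N x -> f x <= g x) ->
  \int[mu]_x f x <= \int[mu]_x g x.
Proof.
move=> mN N0 fi gi fg; pose m x := Num.max (f x) (g x).
have mi : integ m.
  apply: (@integ_le _ (fun x => `|f x| + `|g x|)).
  - by apply: measurable_maxr; exact: integ_measurable.
  - by apply: integD; exact: integ_norm.
  - by move=> x; rewrite /m; case: (leP (f x)) => _; rewrite ?lerDl ?lerDr.
have -> : \int[mu]_x g x = \int[mu]_x m x.
  congr fine; apply: ae_eq_integral => //.
  - exact: measurable_int gi.
  - exact: measurable_int mi.
  - exists N; split=> // x /= nx; apply: contrapT => Nx; apply: nx => _.
    by rewrite /m max_r// fg.
by apply: Rint_le => // x; rewrite /m le_max lexx.
Qed.

Lemma Rint_abs_le f g : integ f -> integ g -> (forall x, `|f x| <= g x) ->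
  `|\int[mu]_x f x| <= \int[mu]_x g x.
Proof.
move=> fi gi fg; apply: le_trans (le_normr_Rintegral _ fi) _ => //.
by apply: Rint_le => //; exact: integ_norm.
Qed.

Lemma Rint_mulr_abs_le c f g : integ f -> measurable_fun setT g ->
  (forall x, `|g x| <= c) ->
  `|\int[mu]_x (f x * g x)| <= c * \int[mu]_x `|f x|.
Proof.
move=> fi mg gc; rewrite -RintZ; last exact: integ_norm.
apply: Rint_abs_le; [exact: integM fi mg gc|exact/integZ/integ_norm|].
by move=> x; rewrite normrM mulrC ler_wpM2r.
Qed.

Lemma integ_itv (a b : R) (ba bb : bool) :
  integ (fun x : R => (\1_[set` Interval (BSide ba a) (BSide bb b)] x : R)).
Proof. exact: integrable_indic_itv. Qed.

Lemma EFin_Rint f : integ f ->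
  (\int[mu]_x f x)%:E = (\int[mu]_x (f x)%:E)%E.
Proof. by move=> fi; rewrite fineK//; exact: integrable_fin_num. Qed.

Section Fubini.
Variables (f g : R -> R) (k : R -> R -> R) (c : R).
Hypotheses (fi : integ f) (gi : integ g).
Hypothesis mk : measurable_fun setT (fun z : R * R => k z.1 z.2).
Hypothesis kc : forall x y, `|k x y| <= c.

Let F (z : R * R) : \bar R := (f z.1 * g z.2 * k z.1 z.2)%:E.

Let mF : measurable_fun setT F.
Proof.
apply/measurable_EFinP; apply: measurable_funM => //.
by apply: measurable_funM;
  [exact: measurableT_comp (integ_measurable fi) _|
   exact: measurableT_comp (integ_measurable gi) _].
Qed.

Lemma measurable_kernel1 x : measurable_fun setT (k x).
Proof.
have := @measurableT_comp _ _ _ _ _ _ _ _ (fun y : R => (x, y)) mk.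
by apply; exact: pair1_measurable.
Qed.

Lemma integ_kernel x : integ (fun y => g y * k x y).
Proof. exact: (integM gi (measurable_kernel1 x) (kc x)). Qed.

Lemma integ_prod : (mu \x mu)%E.-integrable setT F.
Proof.
apply/integrable12ltyP => //.
apply: (@le_lt_trans _ _
  (\int[mu]_x ((c * \int[mu]_y `|g y|) * `|f x|)%:E)%E); last first.
  have /integrableZl : integ (fun x => `|f x|) by exact: integ_norm.
  by move=> /(_ measurableT (c * \int[mu]_y `|g y|)) /integrable_lty; apply.
have c0 : 0 <= c by apply: le_trans (kc 0 0).
apply: ge0_le_integral => //.
- by move=> x _; exact: integral_ge0.
- apply: (@measurable_fun_fubini_tonelli_F _ _
    (measurableTypeR R) (measurableTypeR R) R mu (abse \o F)) => //=.
  exact: measurableT_comp.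
- apply/measurable_EFinP; apply: measurable_funM => //.
  exact: measurableT_comp (integ_measurable fi).
move=> x _; rewrite /F /=.
rewrite (_ : (\int[mu]_y _)%E = (\int[mu]_y `|f x * (g y * k x y)|)%:E).
  rewrite lee_fin.
  under eq_Rintegral => y _ do rewrite normrM.
  rewrite RintZ; last exact/integ_norm/integ_kernel.
  rewrite mulrC ler_wpM2r// -RintZ; last exact: integ_norm.
  apply: Rint_le; [exact/integ_norm/integ_kernel|exact/integZ/integ_norm|].
  by move=> y; rewrite normrM mulrC ler_wpM2r.
rewrite EFin_Rint; last exact/integ_norm/integZ/integ_kernel.
by apply: eq_integral => y _; rewrite mulrA.
Qed.

Lemma measurable_Rint_kernel :
  measurable_fun setT (fun x => f x * \int[mu]_y (g y * k x y)).
Proof.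
apply/measurable_EFinP.
apply: eq_measurable_fun (measurable_fubini_F integ_prod) => x _ /=.
rewrite /fubini_F /F /= -RintZ; last exact: integ_kernel.
rewrite EFin_Rint; last exact/integZ/integ_kernel.
by apply: eq_integral => y _; rewrite mulrA.
Qed.

Lemma integ_Rint_kernel : integ (fun x => f x * \int[mu]_y (g y * k x y)).
Proof.
apply: (@integ_le _ (fun x => (c * \int[mu]_y `|g y|) * `|f x|)).
- exact: measurable_Rint_kernel.
- exact/integZ/integ_norm.
- move=> x; rewrite normrM mulrC ler_wpM2r//.
  exact: (Rint_mulr_abs_le gi (measurable_kernel1 x) (kc x)).
Qed.

End Fubini.

(** A bounded kernel against two integrable weights is dominated on the product
    by the product of the weights. *)
Lemma Rint_swap f g (k : R -> R -> R) c : integ f -> integ g ->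
  measurable_fun setT (fun z : R * R => k z.1 z.2) ->
  (forall x y, `|k x y| <= c) ->
  \int[mu]_x (f x * \int[mu]_y (g y * k x y)) =
  \int[mu]_y (g y * \int[mu]_x (f x * k x y)).
Proof.
move=> fi gi mk kc.
have mk' : measurable_fun setT (fun z : R * R => k z.2 z.1).
  exact: (measurableT_comp mk (@measurable_swap _ _ _ _)).
have kc' x y : `|k y x| <= c by [].
have k1 x := integ_kernel gi mk kc x.
have k2 y := @integ_kernel f (fun y x => k x y) c fi mk' kc' y.
have E1 : \int[mu]_x (f x * \int[mu]_y (g y * k x y)) =
   fine (\int[mu]_x \int[mu]_y (f x * g y * k x y)%:E)%E.
  congr fine; apply: eq_integral => x _.
  rewrite -RintZ// EFin_Rint; last exact: integZ.
  by apply: eq_integral => y _; rewrite mulrA.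
have E2 : \int[mu]_y (g y * \int[mu]_x (f x * k x y)) =
   fine (\int[mu]_y \int[mu]_x (f x * g y * k x y)%:E)%E.
  congr fine; apply: eq_integral => y _.
  rewrite -RintZ// EFin_Rint; last exact: integZ.
  by apply: eq_integral => x _; congr EFin; ring.
rewrite E1 E2; congr fine.
exact: (Fubini (integ_prod fi gi mk kc)).
Qed.

End RealIntegral.

(** * Taylor polynomials of the cosine *)

Section Taylor.
Context {R : realType}.

#[local] Instance is_derive_exprn n (x : R) :
  is_derive x (1 : R) (fun z : R => z ^+ n.+1) (n.+1%:R * x ^+ n).
Proof.
have := @is_deriveX _ _ id n.+1 x 1 1 (is_derive_id _ _).
rewrite /GRing.scale /= mulr1.
by have -> : id ^+ n.+1 = (fun z : R => z ^+ n.+1) by apply/funext => z; rewrite fctE.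
Qed.

Lemma nat1r_factV n (z : R) : n.+1%:R * z / n.+1`!%:R = z / n`!%:R.
Proof.
rewrite factS natrM invfM mulrACA divff ?mul1r//; by rewrite pnatr_eq0.
Qed.

Lemma derive_bound_right (f f' : R -> R) n (u : R) :
  (forall x : R, is_derive x (1 : R) f (f' x)) -> f 0 = 0 ->
  (forall x, 0 <= x -> `|f' x| <= x ^+ n / n`!%:R) -> 0 <= u ->
  f u <= u ^+ n.+1 / n.+1`!%:R.
Proof.
move=> df f0 hf u0.
pose g (x : R) : R := n.+1`!%:R^-1 * x ^+ n.+1 - f x.
have dg (x : R) : is_derive x (1 : R) g (x ^+ n / n`!%:R - f' x).
  have dfx := df x.
  rewrite /g; apply: is_derive_eq.
  by rewrite /GRing.scale /= -(nat1r_factV n (x ^+ n)) mulrC.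
have cg : {within `[0, u], continuous g}.
  apply: continuous_subspaceT => x; apply/differentiable_continuous.
  by apply/derivable1_diffP; case: (dg x).
have [c] := @MVT_segment R g _ 0 u u0 (fun x _ => dg x) cg.
rewrite in_itv/= => /andP[c0 cu] E.
have : 0 <= g u - g 0.
  rewrite E subr0 mulr_ge0// subr_ge0.
  exact: le_trans (ler_norm _) (hf c c0).
by rewrite /g f0 expr0n /= mulr0 !subr0 subr_ge0 mulrC.
Qed.

(** Integrating from 0 gains one power and one factorial, which is what makes the
    remainders below superexponentially small. *)
Lemma derive_bound (f f' : R -> R) n (u : R) :
  (forall x : R, is_derive x (1 : R) f (f' x)) -> f 0 = 0 ->
  (forall x, `|f' x| <= `|x| ^+ n / n`!%:R) ->
  `|f u| <= `|u| ^+ n.+1 / n.+1`!%:R.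
Proof.
move=> df f0 hf.
wlog u0 : u f f' df f0 hf / 0 <= u => [H|].
  have [|u0] := leP 0 u; first exact: H.
  have := H (- u) (fun x => f (- x)) (fun x => - f' (- x)).
  rewrite opprK normrN; apply.
  - move=> x; have := df (- x) => dfx.
    have := @is_derive1_comp _ f -%R x _ _ dfx _.
    by move=> /(_ _ _); rewrite mulrN1; apply.
  - by rewrite -[RHS]f0; congr f; exact: oppr0.
  - by move=> x; rewrite normrN (le_trans (hf _))// normrN.
  - by rewrite oppr_ge0 ltW.
have hf' x : 0 <= x -> `|f' x| <= x ^+ n / n`!%:R.
  by move=> x0; rewrite -{2}(ger0_norm x0).
rewrite (ger0_norm u0) ler_norml (derive_bound_right df f0 hf' u0) andbT lerNl.
apply: (@derive_bound_right (fun x => - f x) (fun x => - f' x)) => //.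
  by rewrite f0 oppr0.
by move=> x x0; rewrite normrN hf'.
Qed.

(** Since a derivative of the cosine is a phase shift by [pi / 2], the remainder of
    order [n.+1] has the remainder of order [n], at a shifted phase, as its
    derivative. *)
Lemma cos_taylor n (y u : R) :
  `|cos (y + u) - \sum_(j < n) u ^+ j / j`!%:R * cos (y + j%:R * (pi / 2))|
  <= `|u| ^+ n / n`!%:R.
Proof.
elim: n y u => [y u|n IH y u].
  by rewrite big_ord0 subr0 expr0 fact0 divr1 cos_max.
pose f n y u : R := cos (y + u)
  - \sum_(j < n) u ^+ j / j`!%:R * cos (y + j%:R * (pi / 2)).
apply: (@derive_bound (f n.+1 y) (f n (y + pi / 2))).
- move=> x.
  pose h (j : 'I_n) (z : R) : R :=
    cos (y + j.+1%:R * (pi / 2)) / j.+1`!%:R * z ^+ j.+1.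
  have -> : f n.+1 y = (fun z => cos (y + z)) - (cst (cos y) + \sum_(j < n) h j).
    apply/funext => z; rewrite /f !fctE fct_sumE big_ord_recl.
    rewrite expr0 fact0 divr1 mul1r mul0r addr0; congr (_ - (_ + _)).
    apply: eq_bigr => j _; rewrite /h lift0 [RHS]mulrC [RHS]mulrA; exact: mulrAC.
  apply: is_derive_eq.
  rewrite /f /GRing.scale /= !add0r mulr1; congr (_ - _).
    by rewrite addrAC cosDpihalf.
  apply: eq_bigr => j _.
  have -> : y + j.+1%:R * (pi / 2) = y + pi / 2 + j%:R * (pi / 2) :> R.
    by rewrite -(natr1 j) mulrDl mul1r addrA addrAC.
  by rewrite -[in RHS]nat1r_factV; ring.
- rewrite /f addr0 big_ord_recl big1 => [|j _].
    by rewrite expr0 fact0 divr1 mul1r mul0r addr0 addr0 subrr.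
  by rewrite exprS !mul0r.
- exact: IH.
Qed.

Lemma cos_lipschitz (x y : R) : `|cos x - cos y| <= `|x - y|.
Proof.
have := cos_taylor 1 y (x - y).
by rewrite big_ord1 expr0 expr1 fact0 !divr1 mul1r mul0r addr0 [y + _]addrC subrK.
Qed.

End Taylor.

(** * The Poisson kernel *)

Section ExplicitIntegrals.
Context {R : realType}.
Local Notation mu := (@lebesgue_measure R).

Lemma Rint_FTC (f F : R -> R) (a b : R) (ba bb : bool) : a < b ->
  (forall x : R, is_derive x (1 : R) F (f x)) -> continuous f ->
  \int[mu]_x (\1_[set` Interval (BSide ba a) (BSide bb b)] x * f x) = F b - F a.
Proof.
move=> ab dF cf.
set A := [set` _].
have -> : \int[mu]_x (\1_A x * f x) = \int[mu]_(x in A) f x.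
  rewrite [RHS]Rintegral_mkcond; apply: Rint_eq => x.
  by rewrite patchE indicE; case: (x \in A); rewrite ?mul1r ?mul0r.
have mf : measurable_fun setT (EFin \o f).
  by apply/measurable_EFinP; exact: continuous_measurable_fun.
rewrite /Rintegral /A integral_itv_bndoo; last exact: measurable_funTS.
rewrite -(@integral_itv_bndoo _ _ _ _ true false); last exact: measurable_funTS.
rewrite (@continuous_FTC2 _ f F)//.
- exact: continuous_subspaceT.
- have cF : continuous F.
    by move=> x; apply/differentiable_continuous/derivable1_diffP; case: (dF x).
  split; first by move=> x _; case: (dF x).
  + exact/cvg_at_right_filter/cF.
  + exact/cvg_at_left_filter/cF.
- by move=> x _; rewrite derive1E; apply: derive_val.
Qed.

Lemma Rint_indic_itv (b c : R) (ba bb : bool) : b < c ->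
  \int[mu]_y (\1_[set` Interval (BSide ba b) (BSide bb c)] y) = c - b.
Proof.
move=> bc.
apply: etrans; last apply: (@Rint_FTC (fun=> 1) id b c ba bb bc).
- by apply: Rint_eq => y; rewrite mulr1.
- by move=> x; exact: cst_continuous.
Qed.

(** [pi] times the Poisson kernel of the half-plane at height [a]. *)
Definition poisson (a t : R) : R := a / (a ^+ 2 + t ^+ 2).

Lemma poisson_den (a t : R) : 0 < a -> 0 < a ^+ 2 + t ^+ 2.
Proof. by move=> a0; rewrite ltr_pwDl ?exprn_gt0// sqr_ge0. Qed.

Lemma poisson_ge0 (a t : R) : 0 < a -> 0 <= poisson a t.
Proof. by move=> a0; rewrite divr_ge0 ?(ltW a0)// ltW// poisson_den. Qed.

Lemma poisson_le (a t : R) : 0 < a -> poisson a t <= a^-1.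
Proof.
move=> a0; rewrite /poisson ler_pdivrMr ?poisson_den// mulrDr expr2 mulKf ?gt_eqF//.
by rewrite lerDl mulr_ge0 ?sqr_ge0// invr_ge0 ltW.
Qed.

Lemma poissonC (a x y : R) : poisson a (x - y) = poisson a (y - x).
Proof. by rewrite /poisson -(opprB y x) sqrrN. Qed.

Lemma continuous_poisson (a : R) : 0 < a -> continuous (poisson a).
Proof.
move=> a0 t.
apply: cvgM; first exact: cvg_cst.
apply: cvgV; first by rewrite gt_eqF ?poisson_den.
apply: cvgD; first exact: cvg_cst.
exact: exprn_continuous.
Qed.

Lemma measurable_poisson (a : R) : 0 < a -> measurable_fun setT (poisson a).
Proof. by move=> /continuous_poisson; exact: continuous_measurable_fun. Qed.

Lemma measurable_poisson2 (a : R) : 0 < a ->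
  measurable_fun setT (fun z : R * R => poisson a (z.1 - z.2)).
Proof.
move=> a0; apply: measurableT_comp; first exact: measurable_poisson.
exact: measurable_funB.
Qed.

Lemma Rint_poisson (a x b c : R) (ba bb : bool) : 0 < a -> b < c ->
  \int[mu]_y (\1_[set` Interval (BSide ba b) (BSide bb c)] y
     * poisson a (x - y)) = atan ((c - x) / a) - atan ((b - x) / a).
Proof.
move=> a0 bc; apply: (@Rint_FTC _ (fun y => atan ((y - x) / a))) => //.
  move=> y; apply: is_derive_eq.
  have h1 := poisson_den (x - y) a0.
  have h2 : 0 < 1 + ((y - x) / a) ^+ 2 by rewrite ltr_pwDl// sqr_ge0.
  rewrite /poisson scaler0 add0r subr0 /GRing.scale /= mulr1.
  have h3 : 0 < a ^+ 2 + (y - x) ^+ 2 by rewrite -(opprB x y) sqrrN.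
  rewrite -[x - y]opprB sqrrN.
  by field; rewrite !gt_eqF.
move=> y; apply: (@continuous_comp _ _ _ (fun y => x - y) (poisson a)).
  by apply: cvgB; [exact: cvg_cst|exact: cvg_id].
exact: continuous_poisson.
Qed.

(** The integrand has the elementary primitive
    e^{-aw}(t sin(tw) - a cos(tw))/(a^2+t^2); minus its value at 0 is the Poisson
    kernel, and its value at [N] is the error. *)
Lemma Rint_exp_cos (a t N : R) : 0 < a -> 0 < N ->
  `| \int[mu]_w ((expR (- a * w) * \1_`[0, N] w) * cos (w * t)) - poisson a t |
  <= 2 / a * expR (- a * N).
Proof.
move=> a0 N0.
pose F w : R := expR (- a * w) * (t * sin (t * w) - a * cos (t * w))
           / (a ^+ 2 + t ^+ 2).
have d0 := poisson_den t a0.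
have -> : \int[mu]_w ((expR (- a * w) * \1_`[0, N] w) * cos (w * t)) = F N - F 0.
  apply: etrans; last apply: (@Rint_FTC (fun w => expR (- a * w) * cos (w * t)) F
    _ _ true false N0).
  - by apply: Rint_eq => w; rewrite mulrA [\1_ _ _ * _]mulrC.
  - move=> w; apply: is_derive_eq; rewrite /GRing.scale /= !mulr1 [w * t]mulrC.
    by field; rewrite gt_eqF.
  - move=> w; apply/differentiable_continuous/derivable1_diffP.
    by apply: ex_derive.
have -> : F N - F 0 - poisson a t =
    expR (- a * N) * ((t * sin (t * N) - a * cos (t * N)) / (a ^+ 2 + t ^+ 2)).
  rewrite /F /poisson !mulr0 sin0 cos0 expR0; field; by rewrite gt_eqF.
rewrite normrM ger0_norm ?expR_ge0// mulrC ler_wpM2r ?expR_ge0//.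
rewrite normrM normfV (gtr0_norm d0) ler_pdivrMr// mulrAC ler_pdivlMr//.
have : `|t * sin (t * N) - a * cos (t * N)| <= `|t| + a.
  rewrite (le_trans (ler_normB _ _))// !normrM (gtr0_norm a0) lerD//.
    by rewrite ler_piMr// sin_max.
  by rewrite ler_piMr ?(ltW a0)// cos_max.
move=> h; apply: (le_trans (ler_wpM2r (ltW a0) h)).
have -> : a ^+ 2 + t ^+ 2 = a ^+ 2 + `|t| ^+ 2 by rewrite real_normK ?num_real.
have := sqr_ge0 (a - `|t|); have := normr_ge0 t; nra.
Qed.
End ExplicitIntegrals.

(** * The damped energy of a Fourier transform *)

Section PoissonEnergy.
Context {R : realType}.
Local Notation mu := (@lebesgue_measure R).
Implicit Types (G : R -> R) (th w x y : R).

Lemma measurable_cosM (th : R) :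
  measurable_fun setT (fun z : R * R => cos (z.1 * z.2 + th)).
Proof.
apply: measurableT_comp.
  by apply: continuous_measurable_fun; exact: continuous_cos.
by apply: measurable_funD => //; exact: measurable_funM.
Qed.

Lemma measurable_cos1 (w th : R) : measurable_fun setT (fun z : R => cos (w * z + th)).
Proof.
exact: (@measurable_kernel1 _ (fun w z : R => cos (w * z + th))
  (measurable_cosM th) w).
Qed.

(** The Fourier transform at frequency [w], read along the phase [th]:
    cosine transform for [th = 0], sine transform for [th = - pi / 2]. *)
Definition fcos (G : R -> R) (th w : R) : R := \int[mu]_z (G z * cos (w * z + th)).

(** The squared modulus of the Fourier transform. *)
Definition fpower (G : R -> R) (w : R) : R :=
  fcos G 0 w ^+ 2 + fcos G (- (pi / 2)) w ^+ 2.

Lemma cosDNpihalf (x : R) : cos (x + - (pi / 2)) = sin x.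
Proof. by rewrite -sinDpihalf subrK. Qed.

Lemma integ_fcos G th w : integ G -> integ (fun z => G z * cos (w * z + th)).
Proof.
by move=> Gi; exact: (integM Gi (measurable_cos1 w th) (fun x => cos_max _)).
Qed.

Lemma fcos_le G th w : integ G -> `|fcos G th w| <= \int[mu]_z `|G z|.
Proof.
move=> Gi; have := Rint_mulr_abs_le Gi (measurable_cos1 w th) (fun x => cos_max _).
by rewrite mul1r.
Qed.

Lemma fcos_lipschitz G r th w w' : integ G -> (forall x, r < `|x| -> G x = 0) ->
  `|fcos G th w - fcos G th w'| <= r * `|w - w'| * \int[mu]_z `|G z|.
Proof.
move=> Gi G0; rewrite -RintB; [|exact: integ_fcos..].
rewrite -RintZ; last exact: integ_norm.
apply: Rint_abs_le; [by apply: integB; exact: integ_fcos| |].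
  exact/integZ/integ_norm.
move=> x; rewrite -mulrBr normrM mulrC.
have [xr|/G0->] := leP `|x| r; last by rewrite normr0 !mulr0.
rewrite ler_wpM2r// (le_trans (cos_lipschitz _ _))//.
by rewrite opprD addrACA subrr addr0 -mulrBl normrM mulrC ler_wpM2r.
Qed.

Section Energy.
Variables (G : R -> R) (r : R).
Hypotheses (Gi : integ G) (Gr : forall x, r < `|x| -> G x = 0).
Let L := \int[mu]_z `|G z|.

Lemma continuous_fcos th : continuous (fcos G th).
Proof.
move=> w; apply/cvgrPdist_le => e e0.
pose c := `|r| * L + 1.
have c0 : 0 < c by rewrite ltr_pwDr// mulr_ge0// Rint_ge0.
near=> w'.
rewrite (le_trans (fcos_lipschitz th w w' Gi Gr))//.
apply: (@le_trans _ _ (c * `|w - w'|)).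
  rewrite mulrAC ler_wpM2r// /c -/L (@le_trans _ _ (`|r| * L)) ?lerDl//.
  by rewrite ler_wpM2r ?Rint_ge0// ler_norm.
rewrite mulrC -ler_pdivlMr//; near: w'.
by apply: cvgr_dist_le; [exact: cvg_id|rewrite divr_gt0].
Unshelve. all: by end_near. Qed.

Lemma continuous_fpower : continuous (fpower G).
Proof.
have c th : continuous (fun w => fcos G th w ^+ 2).
  have -> : (fun w => fcos G th w ^+ 2) = (fun w => fcos G th w * fcos G th w).
    by apply/funext => w; rewrite expr2.
  by move=> w; apply: cvgM; exact: continuous_fcos.
by move=> w; apply: cvgD; exact: c.
Qed.

Let K w x := cos (w * x) * fcos G 0 w + sin (w * x) * fcos G (- (pi / 2)) w.

Lemma fcos_shift w x : \int[mu]_y (G y * cos (w * (x - y))) = K w x.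
Proof.
rewrite /K /fcos -RintZ; last exact: integ_fcos.
rewrite -RintZ; last exact: integ_fcos.
rewrite -RintD; [|exact/integZ/integ_fcos..].
apply: Rint_eq => y; rewrite addr0 cosDNpihalf mulrBr cosB; ring.
Qed.

Lemma fpowerE w : fpower G w = \int[mu]_x (G x * K w x).
Proof.
have i1 th c : integ (fun y => c * (G y * cos (w * y + th))).
  exact/integZ/integ_fcos.
rewrite /fpower !expr2.
rewrite {1}/fcos mulrC -RintZ; last exact: integ_fcos.
rewrite addrC {1}/fcos mulrC -RintZ; last exact: integ_fcos.
rewrite addrC -RintD//; apply: Rint_eq => y.
by rewrite /K addr0 cosDNpihalf; ring.
Qed.

(** The power at [w] is the double integral of [G x * G y * cos (w * (x - y))];
    integrating in [w] first leaves the Poisson kernel in [x - y]. *)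
Lemma poisson_energy (a N : R) : 0 < a -> 0 < N ->
  `| \int[mu]_w (expR (- a * w) * \1_`[0, N] w * fpower G w)
     - \int[mu]_x (G x * \int[mu]_y (G y * poisson a (x - y))) |
  <= 2 / a * expR (- a * N) * L ^+ 2.
Proof.
move=> a0 N0.
pose e w : R := expR (- a * w) * \1_`[0, N] w.
have ei : integ e.
  apply: (@integ_le _ _ (\1_`[0, N] : R -> R)); last 2 first.
  - exact: integ_itv.
  - move=> w; rewrite normrM (ger0_norm (expR_ge0 _)) indicE.
    have [|_] := boolP (w \in _); last by rewrite normr0 mulr0.
    rewrite inE /= in_itv/= => /andP[w0 _].
    rewrite normr1 mulr1 -expR0 ler_expR mulNr oppr_le0 mulr_ge0//.
    exact: ltW.
  apply: measurable_funM; last exact: measurable_indic.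
  apply: measurableT_comp; first exact: measurable_expR.
  exact: mulrl_measurable.
have L0 : 0 <= L by exact: Rint_ge0.
have mK : measurable_fun setT (fun z : R * R => K z.1 z.2).
  have mf th : measurable_fun setT (fun z : R * R => fcos G th z.1).
    apply: measurableT_comp => //.
    by apply: continuous_measurable_fun; exact: continuous_fcos.
  apply: measurable_funD; apply: measurable_funM => //.
  - apply: eq_measurable_fun (measurable_cosM 0) => z _.
    by rewrite addr0.
  - apply: eq_measurable_fun (measurable_cosM (- (pi / 2))) => z _.
    by rewrite cosDNpihalf.
have Kc w x : `|K w x| <= 2 * L.
  rewrite /K (le_trans (ler_normD _ _))// !normrM.
  have -> : 2 * L = 1 * L + 1 * L by ring.
  by rewrite lerD// ler_pM// ?cos_max ?sin_max// fcos_le.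
have mcos x : measurable_fun setT (fun z : R * R => cos (z.1 * (x - z.2))).
  apply: measurableT_comp.
    by apply: continuous_measurable_fun; exact: continuous_cos.
  by apply: measurable_funM => //; exact: measurable_funB.
have ccos x w y : `|cos (w * (x - y))| <= 1 by exact: cos_max.
have sw (k : R -> R -> R) : measurable_fun setT (fun z : R * R => k z.1 z.2) ->
   measurable_fun setT (fun z : R * R => k z.2 z.1).
  by move=> mk; exact: (measurableT_comp mk (@measurable_swap _ _ _ _)).
have inner x : \int[mu]_w (e w * K w x) =
    \int[mu]_y (G y * \int[mu]_w (e w * cos (w * (x - y)))).
  rewrite -(Rint_swap ei Gi (mcos x) (ccos x)).
  by apply: Rint_eq => w; rewrite fcos_shift.
rewrite (_ : \int[mu]_w _ =
    \int[mu]_x (G x * \int[mu]_w (e w * K w x))); last first.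
  rewrite -(Rint_swap ei Gi mK Kc); apply: Rint_eq => w.
  by rewrite -fpowerE.
have i1 : integ (fun x => G x * \int[mu]_w (e w * K w x)).
  exact: (@integ_Rint_kernel _ G e (fun x w => K w x) _ Gi ei (sw _ mK)
    (fun x w => Kc w x)).
have cP x y : `|poisson a (x - y)| <= a^-1.
  by rewrite ger0_norm ?poisson_ge0// poisson_le.
have mP := measurable_poisson2 a0.
have i2 : integ (fun x => G x * \int[mu]_y (G y * poisson a (x - y))).
  exact: (@integ_Rint_kernel _ G G (fun x y => poisson a (x - y)) _ Gi Gi mP cP).
rewrite -RintB//.
have -> : 2 / a * expR (- a * N) * L ^+ 2 =
  \int[mu]_x (2 / a * expR (- a * N) * L * `|G x|).
  by rewrite RintZ ?expr2 ?mulrA//; exact: integ_norm.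
apply: Rint_abs_le; [exact: integB|exact/integZ/integ_norm|move=> x].
rewrite -mulrBr normrM mulrC ler_wpM2r// inner.
have j1 : integ (fun y => G y * \int[mu]_w (e w * cos (w * (x - y)))).
  exact: (@integ_Rint_kernel _ G e (fun y w => cos (w * (x - y))) _ Gi ei
    (sw (fun w y => cos (w * (x - y))) (mcos x)) (fun y w => ccos x w y)).
have j2 : integ (fun y => G y * poisson a (x - y)).
  exact: (@integ_kernel _ G (fun x y => poisson a (x - y)) _ Gi mP cP x).
rewrite -RintB// -RintZ; last exact: integ_norm.
apply: Rint_abs_le; [exact: integB|exact/integZ/integ_norm|move=> y].
by rewrite -mulrBr normrM mulrC ler_wpM2r// Rint_exp_cos.
Qed.

End Energy.
End PoissonEnergy.

(** * The Poisson form *)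

Section PoissonForm.
Context {R : realType}.
Local Notation mu := (@lebesgue_measure R).
Implicit Types (G : R -> R) (a b x y : R).

Definition poisson_form G a : R :=
  \int[mu]_x (G x * \int[mu]_y (G y * poisson a (x - y))).

(** A pointwise comparison of [G x * G y] with the mean of the two squares passes
    to the quadratic form.  The kernel being symmetric, both squares give the
    integral of [G ^+ 2] against [p], the mass that the kernel puts on the window
    [beta].  The sign [s] makes room for an upper and a lower bound. *)
Lemma symmetric_form_compare (G beta : R -> R) (k : R -> R -> R) (c C K s : R)
    (N : set (measurableTypeR R)) :
  let p x := \int[mu]_y (beta y * k x y) in
  integ G -> integ (fun x => G x ^+ 2) -> integ beta -> (forall x, 0 <= beta x) ->
  measurable_fun setT (fun z : R * R => k z.1 z.2) ->
  (forall x y, `|k x y| <= K) -> (forall x y, k x y = k y x) ->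
  (forall x, p x <= C) -> measurable N -> mu N = 0%E -> 0 <= c ->
  (forall x y, ~ N x -> ~ N y ->
    s * (G x * G y) * k x y <=
    s * ((G x ^+ 2 * beta y + beta x * G y ^+ 2) / 2) * k x y
    + c * (beta x * (beta y * k x y + beta y))) ->
  s * \int[mu]_x (G x * \int[mu]_y (G y * k x y)) <=
  s * \int[mu]_x (G x ^+ 2 * p x) +
  c * ((C + \int[mu]_x beta x) * \int[mu]_x beta x).
Proof.
move=> p Gi G2i bi b0 mk kK kC pC mN N0 c0 H.
set m := \int[mu]_x beta x.
pose q x : R := \int[mu]_y (G y ^+ 2 * k x y).
have form_i f g : integ f -> integ g -> integ (fun x => f x * \int[mu]_y (g y * k x y)).
  by move=> fi gi; exact: (integ_Rint_kernel fi gi mk kK).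
have kern_i g x : integ g -> integ (fun y => g y * k x y).
  by move=> gi; exact: (integ_kernel gi mk kK x).
have qi : integ (fun x => beta x * q x) by exact: form_i.
have pi1 : integ (fun x => G x ^+ 2 * p x) by exact: form_i.
have pi2 : integ (fun x => beta x * p x) by exact: form_i.
have Gf : integ (fun x => G x * \int[mu]_y (G y * k x y)) by exact: form_i.
have mbi : integ (fun x => m * beta x) by exact: integZ.
have sw : \int[mu]_x (beta x * q x) = \int[mu]_x (G x ^+ 2 * p x).
  rewrite (@Rint_swap _ beta (fun x => G x ^+ 2) k _ bi G2i mk kK).
  by apply: Rint_eq => y; congr (_ * _); apply: Rint_eq => x; rewrite kC.
have t1 : integ (fun x => G x ^+ 2 * p x + beta x * q x) by exact: integD.
have t2 : integ (fun x => beta x * p x + m * beta x) by exact: integD.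
have h1 : integ (fun x => s / 2 * (G x ^+ 2 * p x + beta x * q x)) by exact: integZ.
have h2 : integ (fun x => c * (beta x * p x + m * beta x)) by exact: integZ.
pose h x := s / 2 * (G x ^+ 2 * p x + beta x * q x) + c * (beta x * p x + m * beta x).
have hi : integ h by exact: integD.
have ineq x : ~ N x -> s * (G x * \int[mu]_y (G y * k x y)) <= h x.
  move=> Nx; rewrite mulrA -RintZ; last exact: kern_i.
  have i0 : integ (fun y => s * G x * (G y * k x y)) by exact/integZ/kern_i.
  have i1 : integ (fun y => (s * G x ^+ 2 / 2) * (beta y * k x y)).
    exact/integZ/kern_i.
  have i2 : integ (fun y => (s * beta x / 2) * (G y ^+ 2 * k x y)).
    exact/integZ/kern_i.
  have i3 : integ (fun y => (c * beta x) * (beta y * k x y)) by exact/integZ/kern_i.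
  have i4 : integ (fun y => (c * beta x) * beta y) by exact: integZ.
  have i12 := integD i1 i2; have i123 := integD i12 i3; have i1234 := integD i123 i4.
  have -> : h x = \int[mu]_y ((s * G x ^+ 2 / 2) * (beta y * k x y)
     + (s * beta x / 2) * (G y ^+ 2 * k x y)
     + (c * beta x) * (beta y * k x y) + (c * beta x) * beta y).
    rewrite (RintD i123 i4) (RintD i12 i3) (RintD i1 i2).
    rewrite (RintZ _ (kern_i _ x bi)) (RintZ _ (kern_i _ x G2i)).
    rewrite (RintZ _ (kern_i _ x bi)) (RintZ _ bi) -/(p x) -/(q x) -/m /h; ring.
  apply: (Rint_le_off mN N0 i0 i1234) => y Ny.
  have := H x y Nx Ny; clear; lra.
rewrite -(RintZ s Gf).
apply: (le_trans (Rint_le_off mN N0 (integZ s Gf) hi ineq)).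
rewrite (RintD h1 h2) (RintZ _ t1) (RintD pi1 qi) sw (RintZ _ t2).
have -> (u : R) : s / 2 * (u + u) = s * u by field.
rewrite lerD2l; apply: (ler_wpM2l c0).
rewrite mulrDl (RintD pi2 mbi) (RintZ m bi) lerD2r -(RintZ C bi).
apply: (Rint_le pi2 (integZ C bi)) => x.
by rewrite mulrC (ler_wpM2r (b0 x)).
Qed.

Section Form.
Variables (G : R -> R) (a b : R).
Hypotheses (a0 : 0 < a) (b0 : 0 < b).
Hypotheses (Gi : integ G) (G2i : integ (fun x => G x ^+ 2)).

Let beta : R -> R := \1_`]- b, b[.
Let p x : R := \int[mu]_y (beta y * poisson a (x - y)).

Let mb : - b < b. Proof. by rewrite gtrN. Qed.

Lemma Rint_poisson_window x : p x = atan ((b - x) / a) + atan ((b + x) / a).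
Proof.
rewrite /p /beta Rint_poisson//; congr (_ + _).
by rewrite -atanN -mulNr opprB opprK addrC.
Qed.

Lemma Rint_poisson_window_le x : p x <= pi.
Proof.
by rewrite Rint_poisson_window [leRHS]splitr lerD// ltW// atan_ltpi2.
Qed.

Lemma integ_poisson_form f g : integ f -> integ g ->
  integ (fun x => f x * \int[mu]_y (g y * poisson a (x - y))).
Proof.
move=> fi gi.
apply: (@integ_Rint_kernel _ f g (fun x y => poisson a (x - y)) a^-1 fi gi).
  exact: measurable_poisson2.
by move=> x y; rewrite ger0_norm ?poisson_ge0// poisson_le.
Qed.

Lemma poisson_form_compare (N : set (measurableTypeR R)) (s c : R) :
  measurable N -> mu N = 0%E -> 0 <= c ->
  (forall x y, ~ N x -> ~ N y ->
    s * (G x * G y) * poisson a (x - y) <=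
    s * ((G x ^+ 2 * beta y + beta x * G y ^+ 2) / 2) * poisson a (x - y)
    + c * (beta x * (beta y * poisson a (x - y) + beta y))) ->
  s * poisson_form G a <=
  s * \int[mu]_x (G x ^+ 2 * p x) + c * ((pi + 2 * b) * (2 * b)).
Proof.
move=> mN N0 c0 H.
have -> : 2 * b = \int[mu]_x beta x by rewrite Rint_indic_itv// opprK mulrDl mul1r.
apply: (@symmetric_form_compare G beta (fun x y => poisson a (x - y)) c pi a^-1 s N
  Gi G2i _ _ _ _ _ Rint_poisson_window_le mN N0 c0 H).
- exact: integ_itv.
- by move=> x; rewrite /beta indicE.
- exact: measurable_poisson2.
- by move=> x y; rewrite ger0_norm ?poisson_ge0// poisson_le.
- by move=> x y; rewrite poissonC.
Qed.

Lemma integ_sqr_window : integ (fun x => G x ^+ 2 * p x).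
Proof.
by apply: (@integ_poisson_form (fun x => G x ^+ 2) beta) => //; exact: integ_itv.
Qed.

Hypothesis Gb : forall x, ~ `]- b, b[%classic x -> G x = 0.

Let beta_in x : `]- b, b[%classic x -> beta x = 1.
Proof. by move=> bx; rewrite /beta indicE mem_set. Qed.

Let beta_out x : ~ `]- b, b[%classic x -> beta x = 0.
Proof. by move=> bx; rewrite /beta indicE memNset. Qed.

(** 2 G(x) G(y) <= G(x)^2 + G(y)^2, and the kernel has total mass [pi]. *)
Lemma poisson_form_le : poisson_form G a <= pi * \int[mu]_x (G x ^+ 2).
Proof.
have := @poisson_form_compare set0 1 0 measurable0 (measure0 _) (lexx _).
rewrite !mul1r mul0r addr0 => H; apply: (le_trans (H _)) => {H}.
  move=> x y _ _; rewrite !mul1r mul0r addr0 ler_wpM2r ?poisson_ge0//.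
  have [bx|/Gb ->] := pselect (`]- b, b[%classic x); last first.
    by rewrite mul0r divr_ge0// addr_ge0// mulr_ge0// sqr_ge0.
  have [bY|/Gb ->] := pselect (`]- b, b[%classic y); last first.
    by rewrite mulr0 divr_ge0// addr_ge0// mulr_ge0// sqr_ge0.
  rewrite !beta_in//; have := sqr_ge0 (G x - G y); nra.
rewrite -RintZ//; apply: Rint_le; [exact: integ_sqr_window|exact: integZ|move=> x].
by rewrite mulrC ler_wpM2r ?sqr_ge0// Rint_poisson_window_le.
Qed.

(** For |t| <= sqrt a the factor |t| is small; beyond, |t| poisson a t <= a / |t|.
    The threshold sqrt a balances the two. *)
Lemma poisson_dist_le t : `|t| * poisson a t <= Num.sqrt a * (poisson a t + 1).
Proof.
have sa : 0 < Num.sqrt a by rewrite sqrtr_gt0.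
have P0 := poisson_ge0 t a0.
have [ts|ts] := leP `|t| (Num.sqrt a).
  by rewrite (@le_trans _ _ (Num.sqrt a * poisson a t)) ?ler_wpM2r// ler_pM2l// lerDl.
rewrite mulrDr mulr1; apply: ler_wpDl; first exact: mulr_ge0 (ltW sa) P0.
have t0 : 0 < `|t| by exact: lt_trans ts.
have d0 := poisson_den t a0.
rewrite /poisson mulrA ler_pdivrMr//.
have -> : a ^+ 2 + t ^+ 2 = a ^+ 2 + `|t| ^+ 2 by rewrite real_normK ?num_real.
have sE : a = Num.sqrt a ^+ 2 by rewrite sqr_sqrtr// ltW.
rewrite {1}sE.
set q := Num.sqrt a in ts sa *.
have : q * `|t| * (`|t| - q) >= 0 by rewrite !mulr_ge0 ?(ltW sa)// subr_ge0 ltW.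
have := sqr_ge0 a.
nra.
Qed.

(** 2 G(x) G(y) = G(x)^2 + G(y)^2 - (G(x) - G(y))^2, and a Hoelder bound on the last
    term makes its contribution of order sqrt a. *)
Lemma poisson_form_ge (N : set (measurableTypeR R)) (A kappa : R) :
  measurable N -> mu N = 0%E -> 0 <= A ->
  (forall x y, `]- b, b[%classic x -> `]- b, b[%classic y -> ~ N x -> ~ N y ->
    (G x - G y) ^+ 2 <= A * `|x - y|) ->
  (forall x, G x != 0 -> kappa <= atan ((b - x) / a) + atan ((b + x) / a)) ->
  kappa * \int[mu]_x (G x ^+ 2) - A * b * (pi + 2 * b) * Num.sqrt a
  <= poisson_form G a.
Proof.
move=> mN N0 A0 hol hk.
have c0 : 0 <= A * Num.sqrt a / 2 by rewrite divr_ge0// mulr_ge0// sqrtr_ge0.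
have := @poisson_form_compare N (-1) _ mN N0 c0.
have HI : kappa * \int[mu]_x (G x ^+ 2) <= \int[mu]_x (G x ^+ 2 * p x).
  rewrite -RintZ//; apply: Rint_le; [exact: integZ|exact: integ_sqr_window|move=> x].
  have [->|Gx] := eqVneq (G x) 0; first by rewrite expr0n mulr0 mul0r.
  by rewrite mulrC ler_wpM2l ?sqr_ge0// Rint_poisson_window hk.
move=> H; suff : forall x y, ~ N x -> ~ N y ->
    -1 * (G x * G y) * poisson a (x - y) <=
    -1 * ((G x ^+ 2 * beta y + beta x * G y ^+ 2) / 2) * poisson a (x - y) +
    A * Num.sqrt a / 2 * (beta x * (beta y * poisson a (x - y) + beta y)).
  by move/H => {}H; lra.
move=> {H} x y Nx Ny.
have P0 := poisson_ge0 (x - y) a0.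
have [bx|bx] := pselect (`]- b, b[%classic x); last first.
  by rewrite (Gb bx) (beta_out bx) expr0n /= !(mul0r, mulr0, addr0).
have [bY|bY] := pselect (`]- b, b[%classic y); last first.
  by rewrite (Gb bY) (beta_out bY) expr0n /= !(mul0r, mulr0, addr0).
rewrite !beta_in//.
have h1 := ler_wpM2r P0 (hol x y bx bY Nx Ny).
have h2 := ler_wpM2l A0 (poisson_dist_le (x - y)).
have : 0 <= A * (Num.sqrt a * (poisson a (x - y) + 1)) -
    (G x - G y) ^+ 2 * poisson a (x - y).
  by rewrite subr_ge0 (le_trans h1)// -mulrA.
rewrite !expr2; lra.
Qed.

End Form.
End PoissonForm.

(** * Test functions *)

Section TentStep.
Context {R : realType}.

(** The increment differs from its linear part by at most h^2, whatever the signs. *)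
Lemma is_derive_mulnorm (u : R) :
  is_derive u (1 : R) (fun z : R => z * `|z|) (2 * `|u|).
Proof.
have H : (fun h : R => h^-1 *: ((h *: (1 : R) + u) * `|h *: (1 : R) + u| - u * `|u|))
    @ 0^' --> 2 * `|u|.
  apply/cvgrPdist_le => e e0; near=> h.
  have h0 : h != 0 by near: h; exact: nbhs_dnbhs_neq.
  rewrite /GRing.scale /= mulr1.
  have -> : 2 * `|u| - h^-1 * ((h + u) * `|h + u| - u * `|u|) =
      - (h^-1 * ((h + u) * `|h + u| - u * `|u| - 2 * `|u| * h)) by field.
  rewrite normrN normrM normfV.
  have : `|(h + u) * `|h + u| - u * `|u| - 2 * `|u| * h| <= `|h| * `|h|.
    rewrite -normrM ler_norml [`|h * h|]ger0_norm -?expr2 ?sqr_ge0//.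
    have := sqr_ge0 h; have := sqr_ge0 u; have := sqr_ge0 (h + u).
    rewrite !expr2.
    case: (ger0P u) => u0; case: (ger0P (h + u)) => hu.
    - by move=> *; apply/andP; split; lra.
    - have : 0 <= u * - (h + u) by rewrite mulr_ge0// oppr_ge0 ltW.
      by move=> *; apply/andP; split; lra.
    - have : 0 <= - u * (h + u) by rewrite mulr_ge0// oppr_ge0 ltW.
      by move=> *; apply/andP; split; lra.
    - by move=> *; apply/andP; split; lra.
  move=> hh; have := ler_wpM2l (ltac:(rewrite invr_ge0//) : 0 <= `|h|^-1) hh.
  rewrite mulKf ?normr_eq0// => /le_trans; apply.
  near: h; apply: dnbhs0_le => //.
apply: DeriveDef; first by apply/cvg_ex; exists (2 * `|u|).
exact: cvg_lim.
Unshelve. all: by end_near. Qed.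

Variable l : R.
Hypothesis l0 : 0 < l.

Definition tent (u : R) : R := (`|u - l| - 2 * `|u| + `|u + l|) / (2 * l ^+ 2).

(** A second difference of the C^1 function z |z|, hence a C^1 transition from -1/2
    to 1/2 with the tent as derivative, given by one formula on the whole line. *)
Definition step (u : R) : R :=
  ((u - l) * `|u - l| - 2 * (u * `|u|) + (u + l) * `|u + l|) / (4 * l ^+ 2).

Lemma is_derive_step (c u : R) :
  is_derive u (1 : R) (fun z => step (z - c)) (tent (u - c)).
Proof.
have E : (fun z => step (z - c)) = (fun z : R => (4 * l ^+ 2)^-1 *
   ((z - (c + l)) * `|z - (c + l)| - 2 * ((z - c) * `|z - c|)
    + (z - (c - l)) * `|z - (c - l)|)).
  apply/funext => z; rewrite /step mulrC !opprD opprK !addrA; congr (_ * (_ + _)).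
have d (k : R) : is_derive u (1 : R) (fun z : R => (z - k) * `|z - k|) (2 * `|u - k|).
  have dk := is_derive_mulnorm (u - k).
  have := @is_derive1_comp _ (fun z : R => z * `|z|) (fun z => z - k) u _ _ dk _.
  by move=> /(_ _ _); rewrite subr0 mulr1; apply.
have d1 := d (c + l); have d2 := d c; have d3 := d (c - l).
rewrite E; apply: is_derive_eq.
rewrite /tent /GRing.scale /= !opprD opprK !addrA.
by field; rewrite gt_eqF.
Qed.

Lemma tent_ge0 u : 0 <= tent u.
Proof.
apply: divr_ge0; last by rewrite mulr_ge0// sqr_ge0.
by case: (ger0P (u - l)) => ?; case: (ger0P u) => ?; case: (ger0P (u + l)) => ?;
  lra.
Qed.

Lemma tent_le u : tent u <= l^-1.
Proof.
have l1 := l0.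
rewrite ler_pdivrMr ?mulr_gt0 ?exprn_gt0//.
have -> : l^-1 * (2 * l ^+ 2) = 2 * l by field; rewrite gt_eqF.
case: (ger0P (u - l)) => ?; case: (ger0P u) => ?; case: (ger0P (u + l)) => ?;
  lra.
Qed.

Lemma tent_out u : l <= `|u| -> tent u = 0.
Proof.
move=> ul; apply/eqP; rewrite mulf_eq0; apply/orP; left; apply/eqP.
have l1 := l0.
by move: ul; case: (ger0P (u - l)) => ?; case: (ger0P u) => ?;
  case: (ger0P (u + l)) => ? ?; lra.
Qed.

Lemma step_left u : u <= - l -> step u = - 2^-1.
Proof.
have l1 := l0; move=> ul.
have h1 : u - l <= 0 by lra.
have h2 : u <= 0 by lra.
have h3 : u + l <= 0 by lra.
rewrite /step (ler0_norm h1) (ler0_norm h2) (ler0_norm h3).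
by field; rewrite gt_eqF.
Qed.

Lemma step_right u : l <= u -> step u = 2^-1.
Proof.
have l1 := l0; move=> ul.
have h1 : 0 <= u - l by lra.
have h2 : 0 <= u by lra.
have h3 : 0 <= u + l by lra.
rewrite /step (ger0_norm h1) (ger0_norm h2) (ger0_norm h3).
by field; rewrite gt_eqF.
Qed.

Lemma step_bound u : `|step u| <= 2^-1.
Proof.
have l1 := l0; rewrite ler_norml /step ler_pdivrMr ?mulr_gt0 ?exprn_gt0//.
rewrite ler_pdivlMr ?mulr_gt0 ?exprn_gt0//.
apply/andP; split;
case: (ger0P (u - l)) => ?; case: (ger0P u) => ?; case: (ger0P (u + l)) => ?; nra.
Qed.

Lemma continuous_tent (c : R) : continuous (fun z => tent (z - c)).
Proof.
move=> z; apply: cvgM; last exact: cvg_cst.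
have cn (k : R) : `|y - c + k| @[y --> z] --> `|z - c + k|.
  by apply: cvg_norm; apply: cvgD; [apply: cvgB; [exact: cvg_id|exact: cvg_cst]|exact: cvg_cst].
apply: cvgD; last exact: cn.
apply: cvgB; first exact: cn.
apply: cvgM; first exact: cvg_cst.
have := cn 0; rewrite addr0; under eq_fun do rewrite addr0; exact.
Qed.

End TentStep.

Section Bump.
Context {R : realType}.
Local Notation mu := (@lebesgue_measure R).
Variables (l x y w th : R).
Hypotheses (l0 : 0 < l) (xy : x <= y).

Definition plateau (z : R) : R := step l (z - x) - step l (z - y).

(** The oscillating factor serves for Fourier transforms; [w = th = 0] leaves the
    plateau itself. *)
Definition bump (z : R) : R := plateau z * cos (w * z + th).

Definition dbump (z : R) : R :=
  (tent l (z - x) - tent l (z - y)) * cos (w * z + th)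
  - w * (plateau z * sin (w * z + th)).

Lemma plateau_out z : ~ `[x - l, y + l]%classic z -> plateau z = 0.
Proof.
have l1 := l0; have xy1 := xy.
rewrite /= in_itv/= => /negP; rewrite negb_and -!ltNge => /orP[] h.
  by rewrite /plateau !step_left ?subrr//; lra.
by rewrite /plateau !step_right ?subrr//; lra.
Qed.

Lemma plateau_in z : x + l <= z -> z <= y - l -> plateau z = 1.
Proof.
have l1 := l0; move=> h1 h2.
rewrite /plateau step_right//; last lra.
rewrite step_left//; last lra.
lra.
Qed.

Lemma plateau_le z : `|plateau z| <= 1.
Proof.
rewrite (splitr 1) (le_trans (ler_normB _ _))//.
by rewrite lerD// div1r step_bound.
Qed.

Lemma is_derive_plateau z :
  is_derive z (1 : R) plateau (tent l (z - x) - tent l (z - y)).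
Proof.
have d1 := is_derive_step l0 x z; have d2 := is_derive_step l0 y z.
by rewrite /plateau; apply: is_deriveB.
Qed.

Lemma continuous_plateau : continuous plateau.
Proof.
move=> z; apply/differentiable_continuous/derivable1_diffP.
by case: (is_derive_plateau z).
Qed.

Lemma is_derive_bump z : is_derive z (1 : R) bump (dbump z).
Proof.
have d1 := is_derive_plateau z.
rewrite /bump; apply: is_derive_eq.
rewrite /dbump /GRing.scale /= !mulr1 addr0 /GRing.scale /=; ring.
Qed.

Lemma continuous_dbump : continuous dbump.
Proof.
have ct (c : R) : continuous (fun z => tent l (z - c)) by exact: continuous_tent.
have cl : continuous (fun z : R => w * z + th).
  move=> z; apply: cvgD; last exact: cvg_cst.
  by apply: cvgM; [exact: cvg_cst|exact: cvg_id].
move=> z; apply: cvgB.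
  apply: cvgM; first by apply: cvgB; exact: ct.
  apply: (continuous_comp (cl z)); exact: continuous_cos.
apply: cvgM; first exact: cvg_cst.
apply: cvgM; first exact: continuous_plateau.
apply: (continuous_comp (cl z)); exact: continuous_sin.
Qed.

Lemma test_function_bump (D : set R) : `[x - l, y + l]%classic `<=` D ->
  test_function D bump.
Proof.
move=> sD.
have sub : closure [set z | bump z != 0] `<=` `[x - l, y + l]%classic.
  have cI : closed `[x - l, y + l]%classic by exact: itv_closed.
  rewrite [X in _ `<=` X](closure_id _).1//; apply: closureS => z /= bz.
  apply: contrapT => nz; move/eqP: bz; apply.
  by rewrite /bump plateau_out// mul0r.
split.
- by move=> z; case: (is_derive_bump z).
- have -> : derive1 bump = dbump.
    by apply/funext => z; rewrite derive1E; apply: derive_val; exact: is_derive_bump.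
  exact: continuous_dbump.
- exact: (subclosed_compact (@closed_closure _ _) (@segment_compact _ _ _) sub).
- exact: subset_trans sD.
Qed.

Lemma weak_derivative_bump (D : set (measurableTypeR R)) (s h : R -> R) :
  weak_derivative D s h -> `[x - l, y + l]%classic `<=` D ->
  \int[mu]_z ((s \_ D) z * dbump z) = - \int[mu]_z ((h \_ D) z * bump z).
Proof.
move=> wd sD; have := wd _ (test_function_bump sD).
have -> : derive1 bump = dbump.
  by apply/funext => z; rewrite derive1E; apply: derive_val; exact: is_derive_bump.
have E (f g : R -> R) : \int[mu]_(x in D) (f x * g x) = \int[mu]_x ((f \_ D) x * g x).
  rewrite Rintegral_mkcond; apply: Rint_eq => z.
  by rewrite !patchE; case: (z \in D); rewrite ?mul0r.
by rewrite !E.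
Qed.

End Bump.

(** * Hoelder continuity from a weak derivative *)

Section Holder.
Context {R : realType}.
Local Notation mu := (@lebesgue_measure R).

Lemma integ_locally (f : R -> R) : integ f -> locally_integrable setT f.
Proof. by move=> fi; apply: open_integrable_locally => //; exact: openT. Qed.

Lemma davg_Rint (f : R -> R) (x l : R) : integ f -> 0 < l ->
  davg f x l = ((2 * l)^-1 * \int[mu]_z (\1_(ball x l) z * `|f z - f x|))%:E.
Proof.
move=> fi l0; rewrite /davg /iavg lebesgue_measure_ball ?(ltW l0)//.
rewrite inver ifF; last by rewrite mulrn_eq0/= gt_eqF.
rewrite EFinM mulr_natl; congr (_ * _)%E.
have mB : measurable (ball x l : set (measurableTypeR R)) by exact: measurable_ball.
rewrite integral_mkcond EFin_Rint; last first.
  apply: (@integ_le _ _ (fun z => `|f z| + `|f x| * \1_(ball x l) z)).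
  - apply: measurable_funM; first exact: measurable_indic.
    apply: measurableT_comp => //; apply: measurable_funB => //.
    exact: integ_measurable.
  - apply: integD; first exact: integ_norm.
    apply: integZ; rewrite ball_itv; exact: integ_itv.
  - move=> z; rewrite indicE; case: (z \in _); last first.
      by rewrite mul0r normr0 mulr0 addr0.
    by rewrite mul1r mulr1 normr_id ler_normB.
apply: eq_integral => z _; rewrite patchE indicE.
by case: (z \in _); rewrite ?mul1r ?mul0r.
Qed.

Lemma tent_Rint (l x : R) : 0 < l -> \int[mu]_z tent l (z - x) = 1.
Proof.
move=> l0.
have ab : x - l < x + l by lra.
have E := @Rint_FTC R (fun z => tent l (z - x)) (fun z => step l (z - x)) _ _
  true false ab (is_derive_step l0 x) (@continuous_tent R l x).
transitivity (step l (x + l - x) - step l (x - l - x)).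
  rewrite -E; apply: Rint_eq => z; rewrite indicE.
  have [|] := boolP (z \in _); first by rewrite mul1r.
  rewrite mul0r notin_setE /= in_itv/= => /negP; rewrite negb_and -!ltNge => zx.
  apply: tent_out => //; case/orP: zx => h.
    by rewrite ler_normr; apply/orP; right; lra.
  by rewrite ler_normr; apply/orP; left; lra.
rewrite step_right//; last lra.
rewrite step_left//; last lra.
lra.
Qed.

Lemma integ_tent (l x : R) : 0 < l -> integ (fun z => tent l (z - x)).
Proof.
move=> l0; apply: (@integ_le _ _ (fun z => l^-1 * \1_`[x - l, x + l] z)).
- by apply: continuous_measurable_fun; exact: continuous_tent.
- exact/integZ/integ_itv.
- move=> z; rewrite ger0_norm ?tent_ge0// indicE.
  have [|] := boolP (z \in _); first by rewrite mulr1 tent_le.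
  rewrite mulr0 notin_setE /= in_itv/= => /negP; rewrite negb_and -!ltNge => zx.
  rewrite tent_out //; case/orP: zx => h.
    by rewrite ler_normr; apply/orP; right; lra.
  by rewrite ler_normr; apply/orP; left; lra.
Qed.

(** The tent has integral 1, height 1/l and support in the ball, so the error is at
    most 1/l times the integral of |f - f(x)| over the ball.  At a Lebesgue point it
    tends to 0 with l. *)
Lemma tent_average (f : R -> R) (l x : R) : integ f -> 0 < l ->
  (`| \int[mu]_z (f z * tent l (z - x)) - f x |%:E <= 2%:E * davg f x l)%E.
Proof.
move=> fi l0; rewrite davg_Rint// -EFinM lee_fin.
have mt : measurable_fun setT (fun z : R => tent l (z - x)).
  by apply: continuous_measurable_fun; exact: continuous_tent.
have bt z : `|tent l (z - x)| <= l^-1.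
  by rewrite ger0_norm ?tent_ge0// tent_le.
have ft : integ (fun z => f z * tent l (z - x)) by exact: (integM fi mt bt).
have ct : integ (fun z => f x * tent l (z - x)) by exact/integZ/integ_tent.
have E1 : f x = \int[mu]_z (f x * tent l (z - x)).
  by rewrite RintZ ?tent_Rint ?mulr1//; exact: integ_tent.
rewrite [X in `|_ - X|]E1 -RintB// [leRHS]mulrA.
have -> : 2 * (2 * l)^-1 = l^-1 by field; rewrite gt_eqF.
have ib : integ (fun z => \1_(ball x l) z * `|f z - f x|).
  apply: (@integ_le _ _ (fun z => `|f z| + `|f x| * \1_(ball x l) z)).
  - apply: measurable_funM; first by apply: measurable_indic; exact: measurable_ball.
    apply: measurableT_comp => //; apply: measurable_funB => //.
    exact: integ_measurable.
  - apply: integD; first exact: integ_norm.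
    apply: integZ; rewrite ball_itv; exact: integ_itv.
  - move=> z; rewrite indicE; case: (z \in _); last first.
      by rewrite mul0r normr0 mulr0 addr0.
    by rewrite mul1r mulr1 normr_id ler_normB.
rewrite -RintZ//; apply: Rint_abs_le; [exact: integB|exact: integZ|move=> z].
rewrite -mulrBl normrM [`|tent _ _|]ger0_norm ?tent_ge0// indicE.
have [|] := boolP (z \in _).
  by rewrite mul1r mulrC ler_wpM2r ?tent_le.
rewrite mul0r mulr0 notin_setE /= /ball /= => /negP; rewrite -leNgt distrC => h.
by rewrite tent_out// mulr0.
Qed.

(** The plateau from [x] to [y] has the difference of the two tents as derivative.
    The weight [q] of the inequality of arithmetic and geometric means, applied to
    the integral of [h] over the plateau, is left free. *)
Lemma weak_derivative_increment (D : set (measurableTypeR R)) (s h : R -> R)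
    (l x y q : R) :
  weak_derivative D s h -> `[x - l, y + l]%classic `<=` D ->
  integ (s \_ D) -> measurable_fun setT (h \_ D) ->
  integ (fun z => (h \_ D) z ^+ 2) -> 0 < l -> x <= y -> 0 < q ->
  `| \int[mu]_z ((s \_ D) z * tent l (z - x)) -
     \int[mu]_z ((s \_ D) z * tent l (z - y)) | <=
  q / 2 * \int[mu]_z ((h \_ D) z ^+ 2) + (y - x + 2 * l) / (2 * q).
Proof.
move=> wd sD si mh h2i l0 xy q0.
have mt c : measurable_fun setT (fun z : R => tent l (z - c)).
  by apply: continuous_measurable_fun; exact: continuous_tent.
have bt c z : `|tent l (z - c)| <= l^-1.
  by rewrite ger0_norm ?tent_ge0// tent_le.
have st c : integ (fun z => (s \_ D) z * tent l (z - c)).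
  exact: (integM si (mt c) (bt c)).
have := @weak_derivative_bump R l x y 0 0 l0 xy D s h wd sD.
have -> : \int[mu]_z ((s \_ D) z * dbump l x y 0 0 z) =
    \int[mu]_z ((s \_ D) z * tent l (z - x)) -
    \int[mu]_z ((s \_ D) z * tent l (z - y)).
  rewrite -RintB//; apply: Rint_eq => z.
  by rewrite /dbump !mul0r addr0 cos0 mulr1 subr0 mulrBr.
move=> ->; rewrite normrN.
have dom z : `|(h \_ D) z * bump l x y 0 0 z| <=
    q / 2 * (h \_ D) z ^+ 2 + (2 * q)^-1 * \1_`[x - l, y + l] z.
  rewrite /bump mul0r addr0 cos0 mulr1 indicE.
  have [zI|] := boolP (z \in _); last first.
    rewrite notin_setE => /(plateau_out l0 xy) ->.
    by rewrite mulr0 normr0 mulr0 addr0 mulr_ge0 ?sqr_ge0// divr_ge0// ltW.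
  rewrite mulr1 normrM (@le_trans _ _ `|(h \_ D) z|)//.
    by rewrite ler_piMr// plateau_le.
  rewrite -[(h \_ D) z ^+ 2]real_normK ?num_real//.
  set a := `|_|; have := sqr_ge0 (q * a - 1); rewrite -[a <= _]subr_ge0.
  have -> : q / 2 * a ^+ 2 + (2 * q)^-1 - a = (2 * q)^-1 * (q * a - 1) ^+ 2.
    by field; rewrite gt_eqF.
  by move=> p0; rewrite mulr_ge0// invr_ge0 mulr_ge0// ltW.
have di : integ (fun z => q / 2 * (h \_ D) z ^+ 2 + (2 * q)^-1 * \1_`[x - l, y + l] z).
  by apply: integD; apply: integZ => //; exact: integ_itv.
apply: (le_trans (Rint_abs_le _ di dom)).
  apply: integ_le di dom; apply: measurable_funM => //.
  apply: continuous_measurable_fun => z.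
  by apply/differentiable_continuous/derivable1_diffP; case: (is_derive_bump x y 0 0 l0 z).
rewrite RintD; [|exact: integZ|by apply: integZ; exact: integ_itv].
rewrite !RintZ//; last exact: integ_itv.
rewrite Rint_indic_itv; last lra.
by rewrite lerD2l mulrC ler_wpM2r ?invr_ge0 ?mulr_ge0 ?(ltW q0)//; lra.
Qed.

(** At two Lebesgue points, shrinking the tents in the previous estimate with
    q = sqrt |x - y| gives Hoelder continuity of exponent 1/2. *)
Lemma weak_derivative_holder (D : set (measurableTypeR R)) (s h : R -> R) (b : R) :
  weak_derivative D s h -> `]- b, b[%classic `<=` D ->
  integ (s \_ D) -> measurable_fun setT (h \_ D) ->
  integ (fun z => (h \_ D) z ^+ 2) ->
  exists N : set (measurableTypeR R), [/\ measurable N, mu N = 0%E &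
    forall x y, `]- b, b[%classic x -> `]- b, b[%classic y -> ~ N x -> ~ N y ->
    ((s \_ D) x - (s \_ D) y) ^+ 2 <=
    ((1 + \int[mu]_z ((h \_ D) z ^+ 2)) / 2) ^+ 2 * `|x - y|].
Proof.
move=> wd bD si mh h2i.
have [N [mN N0 sub]] := lebesgue_differentiation (integ_locally si).
exists N; split=> //.
set J := \int[mu]_z _.
have J0 : 0 <= J by apply: Rint_ge0 => z; exact: sqr_ge0.
set S := s \_ D.
suff H x y : x < y -> `]- b, b[%classic x -> `]- b, b[%classic y -> ~ N x -> ~ N y ->
    (S x - S y) ^+ 2 <= ((1 + J) / 2) ^+ 2 * `|x - y|.
  move=> x y bx bY Nx Ny; have [xy|yx|->] := ltgtP x y; first exact: H.
    by rewrite -(opprB (S y)) sqrrN distrC; exact: H.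
  by rewrite !subrr normr0 expr0n mulr0.
move=> xy; rewrite /= !in_itv/= => /andP[bx _] /andP[_ yb] Nx Ny.
have leb z : ~ N z -> lebesgue_pt S z.
  by move=> Nz; apply: contrapT => h0; apply: Nz; exact: sub.
set q := Num.sqrt (y - x).
have q0 : 0 < q by rewrite sqrtr_gt0 subr_gt0.
have q2 : q ^+ 2 = y - x by rewrite sqr_sqrtr// subr_ge0 ltW.
suff : `|S x - S y| <= (1 + J) / 2 * q.
  rewrite -(@ler_pXn2r _ 2%N)// ?nnegrE// ?mulr_ge0 ?divr_ge0 ?addr_ge0 ?(ltW q0)//.
  by rewrite real_normK ?num_real// exprMn q2 distrC gtr0_norm ?subr_gt0.
apply/ler_addgt0Pr => e e0.
have near_dav z : ~ N z -> \forall l \near (0:R)^'+, (davg S z l < (e / 6)%:E)%E.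
  move=> Nz; have := leb z Nz => /fine_cvgP[fin /cvgrPdist_lt cv].
  have e6 : 0 < e / 6 by rewrite divr_gt0.
  near=> l.
  have f : davg S z l \is a fin_num by near: l; exact: fin.
  rewrite -(fineK f) lte_fin (le_lt_trans (ler_norm _))//.
  rewrite -[fine _]subr0 distrC; near: l; exact: cv.
suff [l [[l0 lx ly le] [dx dy]]] : exists l,
    [/\ 0 < l, - b < x - l, y + l < b & l <= e / 3 * q] /\
    ((davg S x l < (e / 6)%:E)%E /\ (davg S y l < (e / 6)%:E)%E).
  have sI : `[x - l, y + l]%classic `<=` D.
    move=> z /=; rewrite in_itv/= => /andP[z1 z2]; apply: bD => /=.
    by rewrite in_itv/= (lt_le_trans lx z1) (le_lt_trans z2 ly).
  have A := weak_derivative_increment wd sI si mh h2i l0 (ltW xy) q0.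
  have tx := tent_average x si l0; have ty := tent_average y si l0.
  have {}tx : `|\int[mu]_z (S z * tent l (z - x)) - S x| <= e / 3.
    rewrite -lee_fin (le_trans tx)//.
    rewrite (@le_trans _ _ (2%:E * (e / 6)%:E)%E)//.
      by rewrite lee_pmul2l// ?ltW.
    rewrite -EFinM lee_fin; lra.
  have {}ty : `|\int[mu]_z (S z * tent l (z - y)) - S y| <= e / 3.
    rewrite -lee_fin (le_trans ty)//.
    rewrite (@le_trans _ _ (2%:E * (e / 6)%:E)%E)//.
      by rewrite lee_pmul2l// ?ltW.
    rewrite -EFinM lee_fin; lra.
  have lq : l / q <= e / 3 by rewrite ler_pdivrMr.
  have Eq : q / 2 * J + (y - x + 2 * l) / (2 * q) = (1 + J) / 2 * q + l / q.
    by rewrite -q2; field; rewrite gt_eqF.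
  move: A tx ty; rewrite -/J Eq !ler_norml => /andP[? ?] /andP[? ?] /andP[? ?].
  by apply/andP; split; lra.
have : \forall l \near (0:R)^'+,
    [/\ 0 < l, - b < x - l, y + l < b & l <= e / 3 * q] /\
    ((davg S x l < (e / 6)%:E)%E /\ (davg S y l < (e / 6)%:E)%E).
  near=> l; split; split.
  - by near: l; exact: nbhs_right_gt.
  - rewrite ltrBrDr -ltrBrDl; near: l; apply: nbhs_right_lt; lra.
  - rewrite -ltrBrDl; near: l; apply: nbhs_right_lt; lra.
  - near: l; apply: nbhs_right_le; rewrite mulr_gt0//; lra.
  - by near: l; exact: near_dav.
  - by near: l; exact: near_dav.
by move=> /(@filter_ex _ _ _) [l Hl]; exists l.
Unshelve. all: by end_near. Qed.

End Holder.

(** * Square integrable functions and the transform Gamma *)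

Section L2.
Context {R : realType}.
Local Notation mu := (@lebesgue_measure R).
Implicit Types (D : set (measurableTypeR R)) (f g : R -> R).

Lemma in_L2_measurable D f : in_L2 D f -> measurable_fun setT (f \_ D).
Proof. by rewrite /in_L2 inE => /andP[/[!inE]]. Qed.

Lemma in_L2_sqr D f : in_L2 D f -> integ (fun x => (f \_ D) x ^+ 2).
Proof. by move=> /Lfun2_integrable_sqr. Qed.

Lemma L2norm_sqr D f : in_L2 D f ->
  L2norm D f ^+ 2 = \int[mu]_x ((f \_ D) x ^+ 2).
Proof.
move=> fD; have fi := in_L2_sqr fD.
have E : (\int[mu]_x `|(EFin \o (f \_ D)) x| `^ 2 = (\int[mu]_x ((f \_ D) x ^+ 2))%:E)%E.
  rewrite EFin_Rint//; apply: eq_integral => x _.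
  by rewrite /= powR_mulrn// real_normK ?num_real.
rewrite /L2norm unlock E poweR_EFin /= -powR_mulrn ?powR_ge0// -powRrM.
by rewrite mulVf ?pnatr_eq0// powRr1// Rint_ge0// => x; exact: sqr_ge0.
Qed.

Lemma patchB D f g : (f \- g) \_ D = (f \_ D) \- (g \_ D).
Proof.
by apply/funext => x; rewrite /= !patchE; case: (x \in D); rewrite ?subr0.
Qed.

Lemma in_L2B D f g : in_L2 D f -> in_L2 D g -> in_L2 D (f \- g).
Proof.
move=> fD gD; rewrite /in_L2 patchB.
have p1 : (1 <= 2%:E :> \bar R)%E by rewrite lee_fin ler1n.
have [_ clD] := Lfun_addr_closed mu p1.
have E : (f \_ D) \- (g \_ D) = (f \_ D) + (- (g \_ D)) by apply/funext.
by rewrite E; apply: clD => //; exact: Lfun_oppr_closed.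
Qed.

Lemma Rint_sqrB_le f g : integ (fun x => f x ^+ 2) -> integ (fun x => g x ^+ 2) ->
  integ (fun x => (f x - g x) ^+ 2) ->
  \int[mu]_x ((f x - g x) ^+ 2) <=
  2 * (\int[mu]_x (f x ^+ 2) + \int[mu]_x (g x ^+ 2)).
Proof.
move=> fi gi fgi; rewrite -RintD// -RintZ; last exact: integD.
apply: Rint_le => //; first exact/integZ/integD.
by move=> x; have := sqr_ge0 (f x + g x); rewrite !expr2; lra.
Qed.

(** Integrate |f| <= (1 + f^2) / 2 over the interval. *)
Lemma sqr_integ f (r : R) : 0 < r -> measurable_fun setT f ->
  (forall x, ~ `]- r, r[%classic x -> f x = 0) -> integ (fun x => f x ^+ 2) ->
  integ f /\ \int[mu]_x `|f x| <= r + (\int[mu]_x (f x ^+ 2)) / 2.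
Proof.
move=> r0 mf f0 f2.
have di : integ (fun x => 2^-1 * \1_`]- r, r[ x + 2^-1 * f x ^+ 2).
  by apply: integD; apply: integZ => //; exact: integ_itv.
have dom x : `|f x| <= 2^-1 * \1_`]- r, r[ x + 2^-1 * f x ^+ 2.
  rewrite indicE; have [_|] := boolP (x \in _); last first.
    by rewrite notin_setE => /f0 ->; rewrite normr0 mulr0 add0r mulr_ge0 ?sqr_ge0.
  rewrite -[f x ^+ 2]real_normK ?num_real// mulr1.
  by have := sqr_ge0 (`|f x| - 1); rewrite expr2; lra.
have fi : integ f by exact: (integ_le mf di dom).
split=> //; rewrite (le_trans (Rint_le (integ_norm fi) di dom))//.
rewrite RintD; [|by apply: integZ; exact: integ_itv|exact: integZ].
rewrite !RintZ//; last exact: integ_itv.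
by rewrite Rint_indic_itv; lra.
Qed.

Lemma H1norm_le D f (M : R) : in_H1 D f -> 0 < M -> H1norm D f <= M ->
  [/\ in_L2 D (weak_deriv D f), weak_derivative D f (weak_deriv D f),
      \int[mu]_x ((f \_ D) x ^+ 2) <= M ^+ 2 &
      \int[mu]_x ((weak_deriv D f \_ D) x ^+ 2) <= M ^+ 2].
Proof.
move=> [fD [g gD]] M0.
have [hD hwd] : in_L2 D (weak_deriv D f) /\ weak_derivative D f (weak_deriv D f).
  by rewrite /weak_deriv; case: xgetP => [_ _ []//|/(_ g)]; case.
move=> HM; have H : H1norm D f ^+ 2 <= M ^+ 2.
  by rewrite lerXn2r// nnegrE ?sqrtr_ge0 ?(ltW M0).
move: H; rewrite /H1norm sqr_sqrtr; last by rewrite addr_ge0// sqr_ge0.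
rewrite -!L2norm_sqr// => H; split=> //.
- by rewrite (le_trans _ H)// lerDl sqr_ge0.
- by rewrite (le_trans _ H)// lerDr sqr_ge0.
Qed.

(** A test function and its derivative are bounded on the interval, where the
    functions are integrable, so that the integrals split. *)
Lemma weak_derivativeB (r : R) f1 f2 g1 g2 : let D := `]- r, r[%classic in
  0 < r -> in_L2 D f1 -> in_L2 D f2 -> in_L2 D g1 -> in_L2 D g2 ->
  weak_derivative D f1 g1 -> weak_derivative D f2 g2 ->
  weak_derivative D (f1 \- f2) (g1 \- g2).
Proof.
move=> D r0 f1D f2D g1D g2D w1 w2 phi tphi.
have := w1 phi tphi; have := w2 phi tphi; case: tphi => dphi cphi _ _.
have cph : continuous phi.
  by move=> z; apply/differentiable_continuous/derivable1_diffP.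
have rr : - r <= r by lra.
have prod f (k : R -> R) : in_L2 D f -> continuous k ->
    integ (fun z => (f \_ D) z * k z).
  move=> fD ck.
  have ok x : ~ D x -> (f \_ D) x = 0 by move=> nD; rewrite patchE memNset.
  have [fi _] := sqr_integ r0 (in_L2_measurable fD) ok (in_L2_sqr fD).
  have [|c _ hc] := @EVT_max R (fun z => `|k z|) (- r) r rr.
    by apply: continuous_subspaceT => z; apply: cvg_norm; exact: ck.
  apply: (@integ_le _ _ (fun z => `|k c| * `|(f \_ D) z|)).
  - apply: measurable_funM; first exact: integ_measurable.
    exact: continuous_measurable_fun.
  - exact/integZ/integ_norm.
  - move=> z; have [Dz|nz] := pselect (D z); last by rewrite ok// mul0r normr0 mulr0.
    rewrite normrM mulrC ler_wpM2r// hc//.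
    by move: Dz; rewrite /D /= !in_itv/= => /andP[/ltW -> /ltW ->].
have E (f k : R -> R) : \int[mu]_(x in D) (f x * k x) = \int[mu]_x ((f \_ D) x * k x).
  rewrite Rintegral_mkcond; apply: Rint_eq => z.
  by rewrite !patchE; case: (z \in D); rewrite ?mul0r.
have EB f g (k : R -> R) : in_L2 D f -> in_L2 D g -> continuous k ->
   \int[mu]_(x in D) ((f \- g) x * k x) =
   \int[mu]_(x in D) (f x * k x) - \int[mu]_(x in D) (g x * k x).
  move=> fD gD ck; rewrite !E -RintB; [|exact: prod..].
  by apply: Rint_eq => z; rewrite patchB /= mulrBl.
by rewrite !EB// => -> ->; rewrite opprB opprK addrC.
Qed.

End L2.

Section GammaPower.
Context {R : realType}.
Local Notation mu := (@lebesgue_measure R).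

Lemma fcos_B (f g : R -> R) th w : integ f -> integ g ->
  fcos (f \- g) th w = fcos f th w - fcos g th w.
Proof.
move=> fi gi; rewrite /fcos -RintB; [|exact: integ_fcos..].
by apply: Rint_eq => z; rewrite /= mulrBl.
Qed.

Lemma GammaE (f : R -> R) w :
  Gamma f w = ((0 +i* 1) / (2 * w)%:C * (fcos f 0 w +i* fcos f (- (pi / 2)) w))%C.
Proof.
rewrite /Gamma /cintegral; congr (_ * (_ +i* _))%C.
- by apply: Rint_eq => z /=; rewrite addr0 mul0r subr0.
- by apply: Rint_eq => z /=; rewrite cosDNpihalf mul0r addr0.
Qed.

Lemma Gamma_power (f g : R -> R) w : integ f -> integ g -> 0 < w ->
  w ^+ 2 * Normc.normc ((Gamma f \- Gamma g) w) ^+ 2 = fpower (f \- g) w / 4.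
Proof.
move=> fi gi w0.
have -> : (Gamma f \- Gamma g) w = Gamma f w - Gamma g w by [].
rewrite !GammaE -mulrBr.
rewrite /fpower !fcos_B//.
set a := fcos f 0 w; set b := fcos f _ w; set c := fcos g 0 w; set d := fcos g _ w.
rewrite Normc.normcM exprMn.
have -> : Normc.normc ((a +i* b) - (c +i* d))%C ^+ 2 = (a - c) ^+ 2 + (b - d) ^+ 2.
  by rewrite /= sqr_sqrtr// addr_ge0// sqr_ge0.
have -> : Normc.normc ((0 +i* 1) / (2 * w)%:C)%C ^+ 2 = (2 * w) ^- 2.
  have w2 : 0 < 2 * w by rewrite mulr_gt0.
  rewrite Normc.normcM exprMn Normc.normcV exprVn.
  by rewrite /= !expr0n /= !expr1n add0r addr0 sqrtr1 expr1n mul1r sqr_sqrtr// sqr_ge0.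
by field; rewrite gt_eqF.
Qed.

Lemma Hnorm_sqr (f g : R -> R) (u v : R) : 0 <= u -> integ f -> integ g ->
  Hnorm `]u, v[%classic (Gamma f \- Gamma g) ^+ 2 =
  (\int[mu]_w (\1_`]u, v[ w * (fpower (f \- g) w / 4))).
Proof.
move=> u0 fi gi; rewrite /Hnorm sqr_sqrtr; last first.
  by apply: Rintegral_ge0 => w _; rewrite mulr_ge0// sqr_ge0.
rewrite Rintegral_mkcond; apply: Rint_eq => w; rewrite patchE indicE.
have [|_] := boolP (w \in _); last by rewrite mul0r.
rewrite inE => wI; have /andP[uw _] : u < w < v by move: wI; rewrite /= in_itv.
by rewrite mul1r -(Gamma_power fi gi (le_lt_trans u0 uw)).
Qed.

End GammaPower.

(** * Differentiation as multiplication by the frequency *)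

Section Boundary.
Context {R : realType}.
Local Notation mu := (@lebesgue_measure R).

(** |g k| <= lam g^2 + k^2 / (4 lam); with [E] concentrated on a small set both terms
    can be made small. *)
Lemma Rint_edge_le (g : R -> R) (E : R -> R) (lam : R) : integ (fun z => g z ^+ 2) ->
  measurable_fun setT g -> integ E -> (forall z, 0 <= E z) ->
  (forall z, E z ^+ 2 <= 4 * E z) -> 0 < lam ->
  forall k : R -> R, measurable_fun setT k -> (forall z, `|k z| <= E z) ->
  integ (fun z => g z * k z) /\
  `|\int[mu]_z (g z * k z)| <= lam * \int[mu]_z (g z ^+ 2) + \int[mu]_z E z / lam.
Proof.
move=> g2 mg Ei E0 E2 l0 k mk kE.
have i1 : integ (fun z => lam * g z ^+ 2 + lam^-1 * E z).
  by apply: integD; exact: integZ.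
have dom z : `|g z * k z| <= lam * g z ^+ 2 + lam^-1 * E z.
  rewrite normrM (@le_trans _ _ (`|g z| * E z))//; first by rewrite ler_wpM2l.
  rewrite -[g z ^+ 2]real_normK ?num_real//.
  set u := `|g z|.
  have h : u * E z <= lam * u ^+ 2 + lam^-1 * (E z ^+ 2 / 4).
    rewrite -subr_ge0.
    have -> : lam * u ^+ 2 + lam^-1 * (E z ^+ 2 / 4) - u * E z =
      lam^-1 * (lam * u - E z / 2) ^+ 2 by field; rewrite gt_eqF.
    by rewrite mulr_ge0 ?sqr_ge0// invr_ge0 ltW.
  apply: (le_trans h); rewrite lerD2l ler_wpM2l ?invr_ge0 ?(ltW l0)//.
  by rewrite ler_pdivrMr// mulrC.
split; first by apply: integ_le i1 dom; exact: measurable_funM.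
have ig : integ (fun z => g z * k z).
  by apply: integ_le i1 dom; exact: measurable_funM.
rewrite (le_trans (Rint_abs_le ig i1 dom))//.
by rewrite RintD ?RintZ ?[_ / lam]mulrC//; exact: integZ.
Qed.

Lemma measurable_plateau (l x y : R) : 0 < l -> measurable_fun setT (plateau l x y).
Proof.
by move=> l0; apply: continuous_measurable_fun; exact: continuous_plateau.
Qed.

Lemma integ_bump (f : R -> R) (l x y w th : R) : 0 < l -> x <= y ->
  measurable_fun setT f -> integ (fun z => f z ^+ 2) ->
  integ (fun z => f z * bump l x y w th z).
Proof.
move=> l0 xy mf f2; pose E : R -> R := \1_`[x - l, y + l].
have Ei : integ E by exact: integ_itv.
have E0 z : 0 <= E z by rewrite /E indicE.
have E2 z : E z ^+ 2 <= 4 * E z.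
  by rewrite /E indicE; case: (z \in _); rewrite /= expr2; lra.
apply: (Rint_edge_le f2 mf Ei E0 E2 ltr01 _ _).1.
  by apply: measurable_funM; [exact: measurable_plateau|exact: measurable_cos1].
move=> z; rewrite normrM /E indicE.
have [_|] := boolP (z \in _); last first.
  by rewrite notin_setE => /(plateau_out l0 xy) ->; rewrite normr0 mul0r.
by rewrite mulr_ile1// ?cos_max// plateau_le.
Qed.

Section Edge.
Variables (r eta : R).
Hypotheses (eta0 : 0 < eta) (etar : eta <= r / 4).

Definition outer_cutoff : R -> R := plateau eta (- r - eta) (r + eta).

Definition inner_cutoff : R -> R := plateau eta (- r + 2 * eta) (r - 2 * eta).

(** A majorant of the defect of the cutoffs. *)
Definition edge (z : R) : R :=
  2 * (\1_`[- r - 2 * eta, - r + 3 * eta] z + \1_`[r - 3 * eta, r + 2 * eta] z).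

Lemma integ_edge : integ edge.
Proof. by apply/integZ/integD; exact: integ_itv. Qed.

Lemma edge_ge0 z : 0 <= edge z.
Proof. by rewrite mulr_ge0// addr_ge0// indicE. Qed.

Lemma edge_sqr_le z : edge z ^+ 2 <= 4 * edge z.
Proof.
by rewrite /edge !indicE; case: (z \in _); case: (z \in _); rewrite /= !expr2; lra.
Qed.

Lemma Rint_edge : \int[mu]_z edge z = 20 * eta.
Proof.
have e0 := eta0.
rewrite RintZ; last by apply: integD; exact: integ_itv.
rewrite RintD; [|exact: integ_itv..].
by rewrite !Rint_indic_itv; lra.
Qed.

Lemma edge_ge2l z : - r - 2 * eta <= z -> z <= - r + 3 * eta -> 2 <= edge z.
Proof.
move=> z1 z2; rewrite /edge !indicE mem_set; last by rewrite /= in_itv/= z1.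
by rewrite mulrDr mulr1 lerDl mulr_ge0.
Qed.

Lemma edge_ge2r z : r - 3 * eta <= z -> z <= r + 2 * eta -> 2 <= edge z.
Proof.
move=> z1 z2; rewrite /edge !indicE [X in _ + (nat_of_bool X)%:R]mem_set.
  by rewrite mulrDr mulr1 lerDr mulr_ge0.
by rewrite /= in_itv/= z1.
Qed.

Lemma outer_cutoff_in z : - r <= z -> z <= r -> outer_cutoff z = 1.
Proof. by move=> z1 z2; apply: plateau_in => //; lra. Qed.

Lemma inner_cutoff_in z : - r + 3 * eta <= z -> z <= r - 3 * eta ->
  inner_cutoff z = 1.
Proof. by move=> z1 z2; apply: plateau_in => //; lra. Qed.

Lemma cutoff_out z : z < - r - 2 * eta \/ r + 2 * eta < z ->
  outer_cutoff z = 0 /\ inner_cutoff z = 0.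
Proof.
have e0 := eta0; have e1 := etar.
by move=> zo; split; apply: plateau_out => //; try lra;
  rewrite /= in_itv/= => /andP[z1 z2]; case: zo => ?; lra.
Qed.

Lemma inner_cutoff_defect z : - r < z -> z < r -> `|inner_cutoff z - 1| <= edge z.
Proof.
have e0 := eta0; have e1 := etar => z1 z2.
have le2 : `|inner_cutoff z - 1| <= 2.
  rewrite (le_trans (ler_normB _ _))// normr1 [leRHS](_ : 2 = 1 + 1)// lerD2r.
  by apply: plateau_le => //; lra.
have [z3|z3] := leP z (- r + 3 * eta).
  by rewrite (le_trans le2)// edge_ge2l//; lra.
have [z4|z4] := leP (r - 3 * eta) z.
  by rewrite (le_trans le2)// edge_ge2r//; lra.
by rewrite inner_cutoff_in ?subrr ?normr0 ?edge_ge0// ltW.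
Qed.

Lemma cutoff_defect z : `|outer_cutoff z - inner_cutoff z| <= edge z.
Proof.
have e0 := eta0; have e1 := etar.
have le2 : `|outer_cutoff z - inner_cutoff z| <= 2.
  rewrite (le_trans (ler_normB _ _))// [leRHS](_ : 2 = 1 + 1)// lerD//.
    by apply: plateau_le => //; lra.
  by apply: plateau_le => //; lra.
have [z1|z1] := ltP z (- r - 2 * eta).
  by have [|-> ->] := @cutoff_out z; [left|rewrite subrr normr0 edge_ge0].
have [z2|z2] := ltP (r + 2 * eta) z.
  by have [|-> ->] := @cutoff_out z; [right|rewrite subrr normr0 edge_ge0].
have [z3|z3] := leP z (- r + 3 * eta).
  by rewrite (le_trans le2)// edge_ge2l.
have [z4|z4] := leP (r - 3 * eta) z.
  by rewrite (le_trans le2)// edge_ge2r.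
have -> : outer_cutoff z = 1 by apply: outer_cutoff_in; lra.
by rewrite inner_cutoff_in ?subrr ?normr0 ?edge_ge0// ltW.
Qed.

End Edge.

(** When the extension by zero of [s] still has a square integrable weak
    derivative there is no jump at the boundary, so differentiation is
    multiplication by the frequency.  The two cutoffs, one equal to 1 on the
    interval and one supported in its interior, differ by a function
    concentrated near the end points. *)
Lemma fcos_weak_derivative (r : R) (s h g : R -> R) (w th : R) :
  let D : set (measurableTypeR R) := `]- r, r[%classic in
  0 < r -> integ (s \_ D) -> measurable_fun setT (h \_ D) ->
  integ (fun z => (h \_ D) z ^+ 2) -> measurable_fun setT g ->
  integ (fun z => g z ^+ 2) ->
  weak_derivative D s h -> weak_derivative setT (s \_ D) g ->
  w * fcos (s \_ D) (th - pi / 2) w = fcos (h \_ D) th w.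
Proof.
move=> D r0 si mh h2 mg g2 wdD wdT.
set F := s \_ D; set H := h \_ D.
have FT : F \_ setT = F by apply/funext => z; rewrite patchE in_setT.
have gT : g \_ setT = g by apply/funext => z; rewrite patchE in_setT.
have outD (f : R -> R) z : ~ D z -> (f \_ D) z = 0 by move=> nD; rewrite patchE memNset.
have [Hi _] := sqr_integ r0 mh (outD h) h2.
apply/eqP; rewrite -subr_eq0 -normr_le0; apply/ler_addgt0Pr => e e0; rewrite add0r.
pose J := \int[mu]_z (g z ^+ 2) + \int[mu]_z (H z ^+ 2) + 1.
have J0 : 0 < J.
  by rewrite ltr_wpDl// addr_ge0// Rint_ge0// => z; exact: sqr_ge0.
(* The error below is at most lam J + 40 eta / lam. *)
pose lam := e / (2 * J).
have l0 : 0 < lam by rewrite divr_gt0// mulr_gt0.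
pose eta := Num.min (r / 4) (e * lam / 80).
have eta0 : 0 < eta by rewrite lt_min !divr_gt0// mulr_gt0.
have eta1 : eta <= r / 4 by rewrite ge_min lexx.
have eta2 : eta <= e * lam / 80 by rewrite ge_min lexx orbT.
pose x1 := - r - eta; pose y1 := r + eta.
pose x2 := - r + 2 * eta; pose y2 := r - 2 * eta.
have xy1 : x1 <= y1 by rewrite /x1 /y1; clear -r0 eta0; lra.
have xy2 : x2 <= y2 by rewrite /x2 /y2; clear -r0 eta1; lra.
have sub2 : `[x2 - eta, y2 + eta]%classic `<=` D.
  move=> z; rewrite /D /= !in_itv/= /x2 /y2 => /andP[z1 z2].
  by clear -z1 z2 eta0; apply/andP; split; lra.
have W1 := @weak_derivative_bump R eta x1 y1 w th eta0 xy1 setT F g wdT (@subsetT _ _).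
have W2 := @weak_derivative_bump R eta x2 y2 w th eta0 xy2 setT F g wdT (@subsetT _ _).
have W3 := @weak_derivative_bump R eta x2 y2 w th eta0 xy2 D s h wdD sub2.
rewrite FT gT in W1 W2.
pose X := outer_cutoff r eta; pose Y := inner_cutoff r eta.
pose ct (z : R) := cos (w * z + th).
have mct : measurable_fun setT ct by exact: measurable_cos1.
have mX : measurable_fun setT X by exact: measurable_plateau.
have mY : measurable_fun setT Y by exact: measurable_plateau.
have E1 : \int[mu]_z (F z * dbump eta x1 y1 w th z) = - (w * fcos F (th - pi / 2) w).
  rewrite -mulNr -RintZ; last exact: integ_fcos.
  apply: Rint_eq => z; have [Dz|nD] := pselect (D z); last first.
    by rewrite /F outD// !mul0r mulr0.
  move: Dz; rewrite /D /= in_itv/= => /andP[z1 z2].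
  have t1 : tent eta (z - x1) = 0.
    apply: tent_out => //; rewrite ler_normr /x1; clear -z1 z2.
    by apply/orP; left; lra.
  have t2 : tent eta (z - y1) = 0.
    apply: tent_out => //; rewrite ler_normr /y1; clear -z1 z2.
    by apply/orP; right; lra.
  rewrite /dbump t1 t2 -/(outer_cutoff r eta z) outer_cutoff_in ?(ltW z1) ?(ltW z2)//.
  by rewrite subrr mul0r mul1r add0r addrA cosDNpihalf; ring.
pose E := edge r eta.
have Ei : integ E by exact: integ_edge.
have E0 z : 0 <= E z by exact: edge_ge0.
have E2 z : E z ^+ 2 <= 4 * E z by exact: edge_sqr_le.
have EI : \int[mu]_z E z = 20 * eta by exact: Rint_edge.
have XYE z : `|X z - Y z| <= E z by exact: cutoff_defect.
have Y1 z : D z -> `|Y z - 1| <= E z.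
  by rewrite /D /= in_itv/= => /andP[z1 z2]; exact: inner_cutoff_defect.
have mE : measurable_fun setT (\1_D : R -> R).
  by apply: measurable_indic; exact: measurable_itv.
pose k1 z := (X z - Y z) * ct z.
pose k2 z := \1_D z * ((Y z - 1) * ct z).
have mk1 : measurable_fun setT k1.
  by apply: measurable_funM => //; exact: measurable_funB.
have mk2 : measurable_fun setT k2.
  apply: measurable_funM => //; apply: measurable_funM => //.
  exact: measurable_funB.
have k1E z : `|k1 z| <= E z.
  by rewrite normrM (le_trans _ (XYE z))// ler_piMr// cos_max.
have k2E z : `|k2 z| <= E z.
  rewrite /k2 indicE; have [|_] := boolP (z \in D); last by rewrite mul0r normr0.
  rewrite inE => Dz; rewrite mul1r normrM (le_trans _ (Y1 z Dz))//.
  by rewrite ler_piMr// cos_max.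
have [i1 b1] := Rint_edge_le g2 mg Ei E0 E2 l0 mk1 k1E.
have [i2 b2] := Rint_edge_le h2 mh Ei E0 E2 l0 mk2 k2E.
have ipl (f : R -> R) x y : measurable_fun setT f -> integ (fun z => f z ^+ 2) ->
    x <= y -> integ (fun z => f z * bump eta x y w th z).
  by move=> mf f2 xy; exact: integ_bump.
have bX z : bump eta x1 y1 w th z = X z * ct z by [].
have bY z : bump eta x2 y2 w th z = Y z * ct z by [].
have e1 : \int[mu]_z (g z * k1 z) = \int[mu]_z (g z * bump eta x1 y1 w th z)
    - \int[mu]_z (g z * bump eta x2 y2 w th z).
  rewrite -RintB; [|exact: ipl..].
  by apply: Rint_eq => z; rewrite bX bY /k1; ring.
have e2 : \int[mu]_z (H z * k2 z) = \int[mu]_z (H z * bump eta x2 y2 w th z)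
    - fcos H th w.
  rewrite -RintB; [|exact: ipl|exact: integ_fcos].
  apply: Rint_eq => z; rewrite bY -/(ct z) /k2 indicE.
  have [_|] := boolP (z \in D); first by rewrite mul1r; ring.
  by rewrite notin_setE => /(outD h); rewrite -/H => ->; rewrite !mul0r subrr.
have -> : w * fcos F (th - pi / 2) w - fcos H th w =
   \int[mu]_z (g z * k1 z) + \int[mu]_z (H z * k2 z).
  by rewrite e1 e2; move: W1 W2 W3; rewrite E1; clear; lra.
rewrite (le_trans (ler_normD _ _))// (le_trans (lerD b1 b2))// EI.
have h1 : 20 * eta / lam <= e / 4.
  by rewrite ler_pdivrMr//; clear -eta2; lra.
have h2' : lam * J = e / 2 by rewrite /lam; field; rewrite gt_eqF.
rewrite /J in h2'.
move: h1 h2' l0; clear; set lam' := lam; clearbody lam'; lra.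
Qed.

End Boundary.

(** * Energy estimate with a high frequency cutoff *)

Section HighFrequency.
Context {R : realType}.
Local Notation mu := (@lebesgue_measure R).

Lemma exp_tail_small (a L e : R) : 0 < a -> 0 <= L -> 0 < e ->
  exists2 N, 0 < N & 2 / a * expR (- a * N) * L <= e.
Proof.
move=> a0 L0 e0; pose N := 2 * L / (a ^+ 2 * e) + 1.
have d0 : 0 < a ^+ 2 * e by rewrite mulr_gt0// exprn_gt0.
have N0 : 0 < N by rewrite ltr_wpDl// divr_ge0// ?(ltW d0)// mulr_ge0.
exists N => //.
have aN : 0 < a * N by rewrite mulr_gt0.
have h : expR (- a * N) <= (a * N)^-1.
  rewrite mulNr expRN lef_pV2 ?posrE ?expR_gt0//.
  by rewrite (le_trans _ (expR_ge1Dx _))// lerDr.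
have h2 : 2 / a * expR (- a * N) * L <= 2 / a * (a * N)^-1 * L.
  by rewrite ler_wpM2r// ler_wpM2l// divr_ge0// ltW.
apply: (le_trans h2).
have -> : 2 / a * (a * N)^-1 * L = 2 * L / (a ^+ 2 * N).
  by field; rewrite !gt_eqF.
rewrite ler_pdivrMr ?mulr_gt0 ?exprn_gt0// /N.
have -> : e * (a ^+ 2 * (2 * L / (a ^+ 2 * e) + 1)) = 2 * L + e * a ^+ 2.
  by field; rewrite !gt_eqF.
by rewrite lerDl mulr_ge0 ?sqr_ge0// ltW.
Qed.

Lemma sqrt_small (C e : R) : 0 <= C -> 0 < e ->
  exists2 d, 0 < d & forall a, 0 <= a -> a <= d -> C * Num.sqrt a <= e.
Proof.
move=> C0 e0; pose q := e / (C + 1).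
have C1 : 0 < C + 1 by rewrite ltr_wpDl.
have q0 : 0 < q by rewrite divr_gt0.
exists (q ^+ 2) => [|a a0 ad]; first by rewrite exprn_gt0.
have sq : Num.sqrt a <= q.
  by rewrite (le_trans (ler_wsqrtr ad))// sqrtr_sqr gtr0_norm.
rewrite (le_trans (ler_wpM2l C0 sq))// /q mulrCA ler_piMr ?(ltW e0)//.
by rewrite ler_pdivrMr// mul1r lerDl.
Qed.

Lemma atan_window_small (r B e : R) : 0 < r -> 0 <= B -> 0 < e ->
  exists2 d, 0 < d & forall a, 0 < a -> a <= d -> (pi - 2 * atan (r / a)) * B <= e.
Proof.
move=> r0 B0 e0.
have B1 : 0 < B + 1 by rewrite ltr_wpDl.
pose e' := e / (2 * (B + 1)).
have e'0 : 0 < e' by rewrite divr_gt0// mulr_gt0.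
have /cvgrPdist_le /(_ _ e'0) [T [_ HT]] := @cvgy_atan R.
pose U := `|T| + 1.
have U0 : 0 < U by rewrite ltr_wpDl.
exists (r / U) => [|a a0 ad]; first by rewrite divr_gt0.
have Ua : U <= r / a by rewrite ler_pdivlMr// mulrC -ler_pdivlMr.
have : `|pi / 2 - atan (r / a)| <= e'.
  by apply: HT; rewrite (lt_le_trans _ Ua)// (le_lt_trans (ler_norm _))// ltrDl.
rewrite ger0_norm; last by rewrite subr_ge0 ltW// atan_ltpi2.
move=> h; apply: (@le_trans _ _ (2 * e' * B)).
  by rewrite ler_wpM2r//; lra.
rewrite /e'.
have -> : 2 * (e / (2 * (B + 1))) * B = e * (B / (B + 1)) by field; rewrite gt_eqF.
by rewrite ler_piMr ?(ltW e0)// ler_pdivrMr// mul1r lerDl.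
Qed.

Lemma integ_window (f : R -> R) (u v : R) (bu bv : bool) : continuous f ->
  integ (fun w => \1_[set` Interval (BSide bu u) (BSide bv v)] w * f w).
Proof.
move=> cf; have [uv|vu] := leP u v; last first.
  have -> : (fun w => \1_[set` Interval (BSide bu u) (BSide bv v)] w * f w) = cst 0.
    apply/funext => w; rewrite indicE memNset ?mul0r//= in_itv.
    by case: bu; case: bv => /= /andP[? ?]; lra.
  exact: integrable0.
have [|c _ hc] := @EVT_max R (fun z => `|f z|) u v uv.
  by apply: continuous_subspaceT => z; apply: cvg_norm; exact: cf.
apply: (@integ_le _ _ (fun w => `|f c| * \1_[set` Interval (BSide bu u) (BSide bv v)] w)).
- apply: measurable_funM; last exact: continuous_measurable_fun.
  by apply: measurable_indic; exact: measurable_itv.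
- exact/integZ/integ_itv.
- move=> w; rewrite indicE; have [wI|_] := boolP (w \in _); last first.
    by rewrite mul0r normr0 mulr0.
  rewrite mul1r mulr1 hc// in_itv/=.
  by move: wI; rewrite inE /= in_itv; case: bu; case: bv => /= /andP[? ?];
    apply/andP; split; lra.
Qed.

Lemma continuous_expM (a : R) : continuous (fun w : R => expR (- a * w)).
Proof.
move=> w; apply/differentiable_continuous/derivable1_diffP.
by apply: ex_derive.
Qed.

Lemma fpower_ge0 (G : R -> R) w : 0 <= fpower G w.
Proof. by rewrite addr_ge0// sqr_ge0. Qed.

(** The damped energy of [s \_ D] on [0, N] is split at [W].  Above [W] its power is
    that of [h \_ D] divided by w^2 >= W^2, so the energy there is at most W^-2 times
    a Poisson form of [h \_ D].  The lower bound of the Poisson form of [s \_ D] on the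
    window ]-2r, 2r[, which leaves a margin r around the support, becomes [pi]
    times the square norm as the damping tends to 0. *)
Lemma energy_estimate (r W : R) (s h g : R -> R) :
  let D : set (measurableTypeR R) := `]- r, r[%classic in
  0 < r -> 0 < W -> in_L2 D s -> in_L2 D h -> in_L2 setT g ->
  weak_derivative D s h -> weak_derivative setT (s \_ D) g ->
  pi * \int[mu]_x ((s \_ D) x ^+ 2) <=
  \int[mu]_w (\1_`]0, W[ w * fpower (s \_ D) w)
  + pi / W ^+ 2 * \int[mu]_x ((h \_ D) x ^+ 2).
Proof.
move=> D r0 W0 sL hL gL wdD wdT.
set F := s \_ D; set H := h \_ D.
have FT : F \_ setT = F by apply/funext => z; rewrite patchE in_setT.
have gT : g \_ setT = g by apply/funext => z; rewrite patchE in_setT.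
have outD (f : R -> R) z : ~ D z -> (f \_ D) z = 0 by move=> nD; rewrite patchE memNset.
have outF (f : R -> R) z : r < `|z| -> (f \_ D) z = 0.
  move=> rz; apply: outD; rewrite /D /= in_itv/= => /andP[z1 z2].
  by move: rz; rewrite ltr_normr => /orP[] ?; lra.
have mF := in_L2_measurable sL; have F2 := in_L2_sqr sL.
have mH := in_L2_measurable hL; have H2 := in_L2_sqr hL.
have mg := in_L2_measurable gL; have g2 := in_L2_sqr gL; rewrite gT in mg g2.
have [Fi _] := sqr_integ r0 mF (outD s) F2.
have [Hi _] := sqr_integ r0 mH (outD h) H2.
have fr w : w ^+ 2 * fpower F w = fpower H w.
  have E th := @fcos_weak_derivative R r s h g w th r0 Fi mH H2 mg g2 wdD wdT.
  have e0 := E 0; have e1 := E (- (pi / 2)).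
  rewrite sub0r in e0.
  have e2 : fcos F (- (pi / 2) - pi / 2) w = - fcos F 0 w.
    rewrite -[RHS]mulN1r -RintZ; last exact: integ_fcos.
    apply: Rint_eq => z; rewrite addr0 addrA cosDNpihalf sinBpihalf; ring.
  by rewrite /fpower -/H -e0 -/H -e1 e2; ring.
have Fc : continuous (fpower F) by apply: (continuous_fpower Fi (outF s)).
have Hc : continuous (fpower H) by apply: (continuous_fpower Hi (outF h)).
set IF := \int[mu]_x (F x ^+ 2); set IH := \int[mu]_x (H x ^+ 2).
have IF0 : 0 <= IF by apply: Rint_ge0 => z; exact: sqr_ge0.
have r20 : 0 < 2 * r by rewrite mulr_gt0.
have [N0 [mN0 N00 hol]] := weak_derivative_holder wdT
  (@subsetT _ `]- (2 * r), (2 * r)[%classic)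
  (ltac:(by rewrite FT) : integ ((s \_ D) \_ setT))
  (ltac:(by rewrite gT) : measurable_fun setT (g \_ setT))
  (ltac:(by rewrite gT) : integ (fun z => (g \_ setT) z ^+ 2)).
set A := ((1 + _) / 2) ^+ 2 in hol; rewrite FT in hol.
have A0 : 0 <= A by exact: sqr_ge0.
pose L2 := (\int[mu]_z `|F z|) ^+ 2; pose LH2 := (\int[mu]_z `|H z|) ^+ 2.
apply/ler_addgt0Pr => e e0.
have e4 : 0 < e / 4 by lra.
have C0 : 0 <= A * (2 * r) * (pi + 2 * (2 * r)).
  apply: mulr_ge0; first exact: mulr_ge0 A0 (ltW r20).
  by rewrite addr_ge0 ?pi_ge0// mulr_ge0// ltW.
have [d1 d10 hd1] := sqrt_small C0 e4.
have [d2 d20 hd2] := atan_window_small r0 IF0 e4.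
pose a := Num.min d1 d2.
have a0 : 0 < a by rewrite lt_min d10.
have {hd1} h1 : A * (2 * r) * (pi + 2 * (2 * r)) * Num.sqrt a <= e / 4.
  by apply: hd1; [exact: ltW|rewrite ge_min lexx].
have {hd2} h2 : (pi - 2 * atan (r / a)) * IF <= e / 4.
  by apply: hd2 => //; rewrite ge_min lexx orbT.
have L0 : 0 <= L2 + LH2 / W ^+ 2 by rewrite addr_ge0 ?divr_ge0 ?sqr_ge0.
have [N N_gt0 hN] := exp_tail_small a0 L0 e4.
have PF := poisson_energy Fi (outF s) a0 N_gt0.
have PH := poisson_energy Hi (outF h) a0 N_gt0.
rewrite -/(poisson_form F a) -/L2 in PF; rewrite -/(poisson_form H a) -/LH2 in PH.
have low : 2 * atan (r / a) * IF - A * (2 * r) * (pi + 2 * (2 * r)) * Num.sqrt a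
    <= poisson_form F a.
  apply: (@poisson_form_ge R F a (2 * r) a0 r20 Fi F2 _ N0 A _ mN0 N00 A0 hol).
  - move=> x nx; apply: (outD s) => Dx; apply: nx; move: Dx.
    rewrite /D /= !in_itv/= => /andP[x1 x2].
    by clear -x1 x2 r0; apply/andP; split; lra.
  - move=> x Fx; have [Dx|/(outD s)/eqP] := pselect (D x); last by rewrite (negbTE Fx).
    move: Dx; rewrite /D /= in_itv/= => /andP[x1 x2].
    have -> : 2 * atan (r / a) = atan (r / a) + atan (r / a) by ring.
    by rewrite lerD// le_atan// ler_pM2r ?invr_gt0//; clear -x1 x2; lra.
have up : poisson_form H a <= pi * IH.
  by apply: (@poisson_form_le R H a r a0 r0 Hi H2); exact: outD.
pose en w : R := expR (- a * w) * \1_`[0, N] w.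
have eni G : continuous G -> integ (fun w => en w * G w).
  move=> cG; have := @integ_window (fun w => expR (- a * w) * G w) 0 N true false.
  rewrite (_ : (fun w => \1_`[0, N] w * (expR (- a * w) * G w)) = (fun w => en w * G w)).
    apply => w; apply: cvgM; [exact: continuous_expM|exact: cG].
  by apply/funext => w; rewrite mulrA [X in X * _]mulrC.
have split_int : \int[mu]_w (en w * fpower F w) <=
    \int[mu]_w (\1_`]0, W[ w * fpower F w) + (W ^+ 2)^-1 * \int[mu]_w (en w * fpower H w).
  have i1 := @integ_window (fpower F) 0 W false true Fc.
  have i2 : integ (fun w => (W ^+ 2)^-1 * (en w * fpower H w)).
    by apply: integZ; exact: eni.
  rewrite -RintZ; last exact: eni.
  rewrite -RintD//.
  apply: (@Rint_le_off R [set 0]).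
  - exact: measurable_set1.
  - exact: lebesgue_measure_set1.
  - exact: eni.
  - exact: integD.
  move=> w w0; rewrite /en !indicE.
  have [wN|_] := boolP (w \in `[0, N]%classic); last first.
    by rewrite !mulr0 !mul0r mulr0 addr0 mulr_ge0// fpower_ge0.
  have w_gt0 : 0 < w.
    move: wN; rewrite inE /= in_itv/= le_eqVlt => /andP[/predU1P[w00|//] _].
    by exfalso; apply: w0.
  rewrite mulr1 -(fr w).
  have ew : expR (- a * w) <= 1.
    by rewrite -expR0 ler_expR mulNr oppr_le0 mulr_ge0// ltW.
  have [wW|wW] := ltP w W.
    rewrite mem_set; last by rewrite /= in_itv/= w_gt0.
    rewrite mul1r ler_wpDr//.
      rewrite mulr_ge0 ?invr_ge0 ?sqr_ge0// mulr_ge0 ?expR_ge0//.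
      by rewrite mulr_ge0 ?sqr_ge0// fpower_ge0.
    by rewrite ler_piMl// fpower_ge0.
  rewrite ler_wpDl//; first by rewrite mulr_ge0// fpower_ge0.
  rewrite mulrCA ler_wpM2l ?expR_ge0// mulrA ler_peMl ?fpower_ge0//.
  rewrite mulrC ler_pdivlMr ?exprn_gt0// mul1r.
  by rewrite lerXn2r// nnegrE ltW// (lt_le_trans W0).
have W2 : 0 < (W ^+ 2)^-1 by rewrite invr_gt0 exprn_gt0.
set X := \int[mu]_w (en w * fpower F w) in split_int PF.
set Y := \int[mu]_w (en w * fpower H w) in split_int PH.
rewrite distrC in PF.
have {}PF := le_trans (ler_norm _) PF; have {}PH := le_trans (ler_norm _) PH.
have PH' := ler_wpM2l (ltW W2) PH.
have up' := ler_wpM2l (ltW W2) up.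
have hN' : 2 / a * expR (- a * N) * L2 +
    (W ^+ 2)^-1 * (2 / a * expR (- a * N) * LH2) <= e / 4.
  by rewrite (le_trans _ hN)// le_eqVlt; apply/orP; left; apply/eqP; ring.
have -> : pi / W ^+ 2 * IH = (W ^+ 2)^-1 * (pi * IH) by ring.
rewrite mulrBl in h2.
clear PH up; clearbody X Y.
move: e0 PF PH' up' hN' h1 h2 low split_int.
move: (2 / a * _ * L2) (2 / a * _ * LH2) (poisson_form F a) (poisson_form H a).
move: (2 * atan _ * IF) (pi * IF) (pi * IH) (_ * Num.sqrt a).
move: (\int[mu]_w (\1__ w * _)) (W ^+ 2)^-1; clear; move=> *; lra.
Qed.

End HighFrequency.

(** * Quantitative unique continuation *)

Section Continuation.
Context {R : realType}.
Local Notation mu := (@lebesgue_measure R).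
Variables (r B u v : R).
Hypotheses (r0 : 0 < r) (B0 : 0 <= B) (uv : u < v).

Definition energy_ball (F : R -> R) : Prop :=
  [/\ measurable_fun setT F, integ (fun x => F x ^+ 2),
      forall x, ~ `]- r, r[%classic x -> F x = 0 &
      \int[mu]_x (F x ^+ 2) <= B].

Let L := r + B / 2.
Let L0 : 0 < L. Proof. by rewrite ltr_wpDr// divr_ge0. Qed.

Let band (F : R -> R) : R := \int[mu]_w (\1_`]u, v[ w * fpower F w).

Lemma energy_ball_integ F : energy_ball F -> integ F /\ \int[mu]_x `|F x| <= L.
Proof.
move=> [mF F2 F0 FB]; have [Fi FL] := sqr_integ r0 mF F0 F2.
by split=> //; rewrite (le_trans FL)// lerD2l ler_pM2r// invr_gt0.
Qed.

Lemma energy_ball_out F : energy_ball F -> forall x, r < `|x| -> F x = 0.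
Proof.
move=> [_ _ F0 _] x rx; apply: F0; rewrite /= in_itv/= => /andP[x1 x2].
by move: rx; rewrite ltr_normr => /orP[] ?; lra.
Qed.

Lemma energy_ball_mul (F g : R -> R) c : energy_ball F -> measurable_fun setT g ->
  (forall z, `|z| <= r -> `|g z| <= c) ->
  integ (fun z => F z * g z) /\ `|\int[mu]_z (F z * g z)| <= c * L.
Proof.
move=> FB mg gc; have [Fi FL] := energy_ball_integ FB.
have c0 : 0 <= c by apply: le_trans (gc 0 _); rewrite ?normr0 ?(ltW r0).
have dom z : `|F z * g z| <= c * `|F z|.
  have [zr|/(energy_ball_out FB) ->] := leP `|z| r; last by rewrite mul0r normr0 mulr0.
  by rewrite normrM mulrC ler_wpM2r// gc.
have i1 : integ (fun z => c * `|F z|) by exact/integZ/integ_norm.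
have i2 : integ (fun z => F z * g z).
  by apply: integ_le i1 dom; apply: measurable_funM => //; exact: integ_measurable.
split=> //; rewrite (le_trans (Rint_abs_le i2 i1 dom))// RintZ; last exact: integ_norm.
by rewrite ler_wpM2l.
Qed.

(** Continuity at 0 of the functional given by the kernel, uniformly over the ball,
    when smallness of [F] means small energy of its Fourier transform in the band. *)
Definition controlled (g : R -> R) : Prop := forall tau : R, 0 < tau ->
  exists2 kap, 0 < kap & forall F, energy_ball F -> band F < kap ->
  `|\int[mu]_z (F z * g z)| <= tau.

(** Cauchy-Schwarz in the plane against the unit vector of angle [th]. *)
Lemma fcos_sqr_le (F : R -> R) th w : integ F -> fcos F th w ^+ 2 <= fpower F w.
Proof.
move=> Fi.
have -> : fcos F th w = cos th * fcos F 0 w - sin th * fcos F (- (pi / 2)) w.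
  rewrite /fcos -!RintZ; [|exact: integ_fcos..].
  rewrite -RintB; [|exact/integZ/integ_fcos..].
  by apply: Rint_eq => z; rewrite addr0 cosDNpihalf cosD; ring.
rewrite /fpower; set a := fcos F 0 w; set b := fcos F _ w.
have := cos2Dsin2 th; set c := cos th; set s := sin th => cs.
rewrite -subr_ge0.
have -> : a ^+ 2 + b ^+ 2 - (c * a - s * b) ^+ 2 =
  (s * a + c * b) ^+ 2 + (1 - (c ^+ 2 + s ^+ 2)) * (a ^+ 2 + b ^+ 2) by ring.
by rewrite cs subrr mul0r addr0 sqr_ge0.
Qed.

(** The transform is Lipschitz with a constant common to the ball, so that a large
    value at a point of the band persists on an interval of fixed length. *)
Lemma controlled_cos (w th : R) : u < w < v -> controlled (fun z => cos (w * z + th)).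
Proof.
move=> /andP[uw wv] tau tau0.
(* On ]w, w + l[ the transform varies by at most tau / 2. *)
pose l := Num.min (tau / (2 * r * L)) ((v - w) / 2).
have d0 : 0 < 2 * r * L by rewrite !mulr_gt0.
have l0 : 0 < l by rewrite lt_min !divr_gt0// subr_gt0.
have l1 : l <= tau / (2 * r * L) by rewrite ge_min lexx.
have l2 : l <= (v - w) / 2 by rewrite ge_min lexx orbT.
exists (l * (tau ^+ 2 / 4)); first by rewrite mulr_gt0// divr_gt0// exprn_gt0.
move=> F FB; have [Fi FL] := energy_ball_integ FB.
have Fo := energy_ball_out FB.
apply: contraPT; rewrite -ltNge => big; apply/negP; rewrite -leNgt.
have wl : w < w + l by rewrite ltrDl.
have -> : l * (tau ^+ 2 / 4) = \int[mu]_x (tau ^+ 2 / 4 * \1_`]w, w + l[ x).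
  by rewrite RintZ; [rewrite Rint_indic_itv//; ring|exact: integ_itv].
have cF := continuous_fpower Fi Fo.
apply: Rint_le; [exact/integZ/integ_itv|exact: integ_window|move=> x].
rewrite indicE; have [|_] := boolP (x \in _); last first.
  by rewrite mulr0 mulr_ge0 ?fpower_ge0// indicE.
rewrite inE /= in_itv/= => /andP[x1 x2].
rewrite mulr1 indicE mem_set; last by rewrite /= in_itv/=; apply/andP; split; lra.
rewrite mul1r (le_trans _ (fcos_sqr_le th x Fi))//.
have lip := fcos_lipschitz th w x Fi Fo.
have lip2 : r * `|w - x| * \int[mu]_z `|F z| <= tau / 2.
  apply: (@le_trans _ _ (r * l * L)).
    rewrite ler_pM ?Rint_ge0// ?mulr_ge0 ?(ltW r0)// ler_pM2l//.
    by rewrite ler_norml; apply/andP; split; lra.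
  have := ler_wpM2l (ltW d0) l1.
  by rewrite mulrCA divff ?gt_eqF// mulr1; lra.
have : tau / 2 <= `|fcos F th x|.
  have := ler_normD (fcos F th w - fcos F th x) (fcos F th x).
  rewrite subrK => h; have := le_trans lip lip2 => h'.
  have : tau < `|fcos F th w| by [].
  lra.
move=> h; rewrite -[fcos F th x ^+ 2]real_normK ?num_real//.
have -> : tau ^+ 2 / 4 = (tau / 2) ^+ 2 by field.
by rewrite lerXn2r// nnegrE ?normr_ge0// divr_ge0// ltW.
Qed.

Lemma measurable_polycos j w th :
  measurable_fun setT (fun z : R => z ^+ j * cos (w * z + th)).
Proof.
by apply: measurable_funM; [exact: exprn_measurable|exact: measurable_cos1].
Qed.

Lemma polycos_le j w th z : `|z| <= r -> `|z ^+ j * cos (w * z + th)| <= r ^+ j.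
Proof.
move=> zr; rewrite normrM normrX (@le_trans _ _ (`|z| ^+ j))//.
  by rewrite ler_piMr ?exprn_ge0// cos_max.
by rewrite lerXn2r// nnegrE// ltW.
Qed.

(** Differentiating in the frequency multiplies the kernel by [z]; the second
    order Taylor bound makes the difference quotients converge uniformly. *)
Lemma controlled_polycos j (w th : R) : u < w < v ->
  controlled (fun z => z ^+ j * cos (w * z + th)).
Proof.
elim: j w th => [|j IH] w th uwv.
  rewrite (_ : (fun z => _) = (fun z => cos (w * z + th))).
    exact: controlled_cos.
  by apply/funext => z; rewrite expr0 mul1r.
move=> tau tau0; have /andP[uw wv] := uwv.
have rj : 0 < r ^+ j.+2 by rewrite exprn_gt0.
pose t := Num.min (tau / (r ^+ j.+2 * L)) ((v - w) / 2).
have d0 : 0 < r ^+ j.+2 * L by rewrite mulr_gt0.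
have t0 : 0 < t by rewrite lt_min !divr_gt0// subr_gt0.
have t1 : t <= tau / (r ^+ j.+2 * L) by rewrite ge_min lexx.
have t2 : t <= (v - w) / 2 by rewrite ge_min lexx orbT.
have uwtv : u < w + t < v by apply/andP; split; lra.
have tau4 : 0 < t * tau / 4 by rewrite divr_gt0// mulr_gt0.
pose th' := th - pi / 2.
have [k1 k10 h1] := IH (w + t) th' uwtv _ tau4.
have [k2 k20 h2] := IH w th' uwv _ tau4.
exists (Num.min k1 k2); first by rewrite lt_min k10.
move=> F FB; rewrite lt_min => /andP[b1 b2].
have {}h1 := h1 F FB b1; have {}h2 := h2 F FB b2.
have [i1 _] := energy_ball_mul FB (measurable_polycos j (w + t) th')
  (@polycos_le j (w + t) th').
have [i2 _] := energy_ball_mul FB (measurable_polycos j w th') (@polycos_le j w th').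
have [i3 _] := energy_ball_mul FB (measurable_polycos j.+1 w th) (@polycos_le j.+1 w th).
pose E z := z ^+ j * cos ((w + t) * z + th') - z ^+ j * cos (w * z + th')
   - t * (z ^+ j.+1 * cos (w * z + th)).
have mE : measurable_fun setT E.
  apply: measurable_funB; first by apply: measurable_funB; exact: measurable_polycos.
  by apply: measurable_funM => //; exact: measurable_polycos.
have EE z : `|z| <= r -> `|E z| <= t ^+ 2 * r ^+ j.+2 / 2.
  move=> zr.
  have -> : E z = z ^+ j * (cos (w * z + th' + t * z) - (cos (w * z + th')
       + t * z * cos (w * z + th))).
    have -> : w * z + th' + t * z = (w + t) * z + th' by ring.
    by rewrite /E exprS; ring.
  have := cos_taylor 2 (w * z + th') (t * z).
  rewrite !big_ord_recr big_ord0 /= add0r expr0 expr1 fact0.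
  have -> : (1`!)%:R = 1 :> R by [].
  rewrite !divr1 !mul1r mul0r addr0.
  have -> : w * z + th' + pi / 2 = w * z + th by rewrite /th'; ring.
  move=> T; rewrite normrM normrX.
  apply: (le_trans (ler_wpM2l (exprn_ge0 j (normr_ge0 z)) T)).
  rewrite normrM (gtr0_norm t0) exprMn.
  have -> : (2`!)%:R = 2 :> R by [].
  have -> : `|z| ^+ j * (t ^+ 2 * `|z| ^+ 2 / 2) = t ^+ 2 / 2 * `|z| ^+ j.+2.
    by rewrite -[j.+2]addn2 exprD; ring.
  have -> : t ^+ 2 * r ^+ j.+2 / 2 = t ^+ 2 / 2 * r ^+ j.+2 by ring.
  rewrite ler_wpM2l ?divr_ge0 ?sqr_ge0// lerXn2r// nnegrE ?normr_ge0//.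
  exact: ltW.
have [iE bE] := energy_ball_mul FB mE EE.
have eqE : \int[mu]_z (F z * E z) =
    \int[mu]_z (F z * (z ^+ j * cos ((w + t) * z + th'))) -
    \int[mu]_z (F z * (z ^+ j * cos (w * z + th'))) -
    t * \int[mu]_z (F z * (z ^+ j.+1 * cos (w * z + th))).
  rewrite -RintZ// -RintB// -RintB//; [|exact: integB|exact: integZ].
  by apply: Rint_eq => z; rewrite /E; ring.
have bE' : t ^+ 2 * r ^+ j.+2 / 2 * L <= t * tau / 2.
  have := ler_wpM2l (ltW d0) t1.
  rewrite mulrCA divff ?gt_eqF// mulr1 => h.
  have := ler_wpM2l (ltW t0) h; lra.
rewrite -(ler_pM2l t0) -[t in t * `|_|](gtr0_norm t0) -normrM.
move: h1 h2 (le_trans bE bE'); rewrite eqE !ler_norml.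
move=> /andP[? ?] /andP[? ?] /andP[? ?]; apply/andP; split; lra.
Qed.

Lemma controlled_family (g : nat -> R -> R) n (tau : R) : 0 < tau ->
  (forall j, controlled (g j)) ->
  exists2 kap, 0 < kap & forall F, energy_ball F -> band F < kap ->
  forall j, (j < n)%N -> `|\int[mu]_z (F z * g j z)| <= tau.
Proof.
move=> tau0 cg; elim: n => [|n [k1 k10 h1]]; first by exists 1.
have [k2 k20 h2] := cg n tau tau0.
exists (Num.min k1 k2); first by rewrite lt_min k10.
move=> F FB; rewrite lt_min => /andP[b1 b2] j.
by rewrite ltnS leq_eqVlt => /predU1P[->|]; [exact: h2|exact: h1].
Qed.

Lemma Rint_lin_sum n (f : nat -> R -> R) (c : nat -> R) :
  (forall j, integ (f j)) ->
  integ (fun z => \sum_(j < n) c j * f j z) /\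
  \int[mu]_z (\sum_(j < n) c j * f j z) = \sum_(j < n) c j * \int[mu]_z f j z.
Proof.
move=> fi; elim: n => [|n [i1 e1]].
  under eq_fun do rewrite big_ord0; rewrite big_ord0; split.
    exact: integrable0.
  by rewrite (@Rint_eq R _ (cst 0)) ?Rintegral_cst ?mul0r// => z; rewrite big_ord0.
have E : (fun z => \sum_(j < n.+1) c j * f j z) =
    (fun z => \sum_(j < n) c j * f j z + c n * f n z).
  by apply/funext => z; rewrite big_ord_recr.
have ic : integ (fun z => c n * f n z) by exact: integZ.
rewrite E; split; first exact: integD.
by rewrite RintD// RintZ// e1 big_ord_recr.
Qed.

(** The Taylor polynomial at the middle of the band approximates the transform
    uniformly on [0, W], and its coefficients are integrals against controlled
    kernels. *)
Lemma fcos_continuation (th W tau : R) : 0 < W -> 0 < tau ->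
  exists2 kap, 0 < kap & forall F, energy_ball F -> band F < kap ->
  forall w, 0 <= w <= W -> `|fcos F th w| <= tau.
Proof.
move=> W0 tau0; pose w0 := (u + v) / 2.
have uwv : u < w0 < v.
  by have uv1 := uv; rewrite /w0; apply/andP; split; lra.
pose T := W + `|w0|.
have T0 : 0 < T by rewrite ltr_wpDr.
have [n hn] : exists n, (T * r) ^+ n / n`!%:R * L <= tau / 2.
  have cv : exp_coeff (T * r) @ \oo --> (0 : R).
    exact: cvg_series_cvg_0 (is_cvg_series_exp_coeff _).
  have e0 : 0 < tau / (2 * L) by rewrite divr_gt0// mulr_gt0.
  have [n _ /(_ n (leqnn _))] := (cvgrPdist_le _ _).1 cv _ e0.
  rewrite /= sub0r normrN => h; exists n.
  have {}h := le_trans (ler_norm _) h.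
  rewrite -ler_pdivlMr// (le_trans h)// le_eqVlt; apply/orP; left.
  by apply/eqP; field; rewrite gt_eqF.
(* [C] bounds the n coefficients (w - w0)^j / j! of the Taylor polynomial. *)
pose C := (1 + T) ^+ n.
have C0 : 0 < C by rewrite exprn_gt0// addr_gt0.
pose tau' := tau / (2 * n.+1%:R * C).
have tau'0 : 0 < tau' by rewrite divr_gt0// !mulr_gt0.
pose g j (z : R) := z ^+ j * cos (w0 * z + (th + j%:R * (pi / 2))).
have [kap k0 hk] := @controlled_family g n _ tau'0
  (fun j => controlled_polycos j (th + j%:R * (pi / 2)) uwv).
exists kap => // F FB Fk w /andP[w1 w2].
have {}hk := hk F FB Fk.
have wT : `|w - w0| <= T.
  by rewrite (le_trans (ler_normB _ _))// lerD2r ger0_norm.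
pose c j : R := (w - w0) ^+ j / j`!%:R.
have gi j : integ (fun z => F z * g j z).
  by have [] := energy_ball_mul FB (measurable_polycos j w0 (th + j%:R * (pi / 2)))
    (@polycos_le j w0 (th + j%:R * (pi / 2))).
have [si sE] := @Rint_lin_sum n (fun j z => F z * g j z) c gi.
have [Fi _] := energy_ball_integ FB.
pose E z := cos (w * z + th) - \sum_(j < n) c j * g j z.
have mE : measurable_fun setT E.
  apply: measurable_funB; first exact: measurable_cos1.
  apply: measurable_sum => j; apply: measurable_funM => //.
  exact: measurable_polycos.
have EE z : `|z| <= r -> `|E z| <= (T * r) ^+ n / n`!%:R.
  move=> zr; have := cos_taylor n (w0 * z + th) ((w - w0) * z).
  have -> : w0 * z + th + (w - w0) * z = w * z + th by ring.
  have -> : \sum_(j < n) ((w - w0) * z) ^+ j / j`!%:R * cos (w0 * z + th + j%:R * (pi / 2))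
    = \sum_(j < n) c j * g j z.
    by apply: eq_bigr => j _; rewrite /c /g exprMn addrA; ring.
  move=> /le_trans; apply; rewrite ler_pM2r ?invr_gt0 ?ltr0n ?fact_gt0//.
  rewrite lerXn2r// ?nnegrE ?mulr_ge0 ?(ltW T0) ?(ltW r0)// normrM.
  by rewrite ler_pM.
have [iE bE] := energy_ball_mul FB mE EE.
have -> : fcos F th w =
    \int[mu]_z (F z * E z) + \sum_(j < n) c j * \int[mu]_z (F z * g j z).
  rewrite -sE -RintD//; apply: Rint_eq => z; rewrite /E mulrBr.
  rewrite mulr_sumr -[LHS]addr0 -addrA; congr (_ + _).
  rewrite addrC; apply/esym/eqP; rewrite subr_eq0; apply/eqP.
  by apply: eq_bigr => j _; rewrite mulrCA.
rewrite (le_trans (ler_normD _ _))// (splitr tau) lerD//; first exact: le_trans bE hn.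
rewrite (le_trans (ler_norm_sum _ _ _))//.
apply: (@le_trans _ _ (\sum_(j < n) C * tau')).
  apply: ler_sum => j _; rewrite normrM ler_pM ?hk//.
  rewrite /c normrM normfV normrX [`|j`!%:R|]ger0_norm//.
  apply: (@le_trans _ _ (`|w - w0| ^+ j)).
    by rewrite ler_pdivrMr ?ltr0n ?fact_gt0// ler_peMr ?exprn_ge0// ler1n fact_gt0.
  apply: (@le_trans _ _ ((1 + T) ^+ j)).
    have T1 : 0 <= 1 + T by rewrite addr_ge0// ltW.
    by rewrite lerXn2r ?nnegrE// (le_trans wT)// lerDr.
  by rewrite /C ler_weXn2l ?lerDl ?(ltW T0)// ltnW.
rewrite sumr_const card_ord /tau'.
have -> : (C * (tau / (2 * n.+1%:R * C))) *+ n = tau / 2 * (n%:R / n.+1%:R) :> R.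
  have nn : 1 + n%:R != 0 :> R by rewrite nat1r pnatr_eq0.
  by rewrite -mulr_natr; field; rewrite nn gt_eqF.
rewrite ler_piMr ?divr_ge0 ?(ltW tau0)// ler_pdivrMr ?ltr0n// mul1r ler_nat.
exact: leqnSn.
Qed.

Lemma fpower_continuation (W tau : R) : 0 < W -> 0 < tau ->
  exists2 kap, 0 < kap & forall F, energy_ball F -> band F < kap ->
  forall w, 0 <= w <= W -> fpower F w <= tau.
Proof.
move=> W0 tau0; pose q := Num.sqrt (tau / 2).
have q0 : 0 < q by rewrite sqrtr_gt0 divr_gt0.
have [k1 k10 h1] := fcos_continuation 0 W0 q0.
have [k2 k20 h2] := fcos_continuation (- (pi / 2)) W0 q0.
exists (Num.min k1 k2); first by rewrite lt_min k10.
move=> F FB; rewrite lt_min => /andP[b1 b2] w wW.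
have sq (x : R) : `|x| <= q -> x ^+ 2 <= tau / 2.
  move=> xq; rewrite -[x ^+ 2]real_normK ?num_real//.
  rewrite -(@sqr_sqrtr _ (tau / 2)) ?divr_ge0 ?(ltW tau0)//.
  by rewrite lerXn2r// nnegrE// ltW.
by rewrite /fpower (splitr tau) lerD// sq// ?h1 ?h2.
Qed.

(** At a fixed small damping the Poisson form is at least about pi/4 times the square
    norm, because a point of the interval has at least one side of length r in it and
    atan 1 = pi/4.  So the damped energy on some [0, N] is not small, which unique
    continuation excludes when the energy in the band is small. *)
Lemma band_energy_lower_bound (A delta : R) : 0 <= A -> 0 < delta ->
  exists2 kap, 0 < kap & forall F, energy_ball F ->
  (exists N : set (measurableTypeR R), [/\ measurable N, mu N = 0%E &
    forall x y, `]- r, r[%classic x -> `]- r, r[%classic y -> ~ N x -> ~ N y ->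
    (F x - F y) ^+ 2 <= A * `|x - y|]) ->
  delta < \int[mu]_x (F x ^+ 2) -> kap <= band F.
Proof.
move=> A0 d0.
have d8 : 0 < delta / 8 by lra.
have C0 : 0 <= A * r * (pi + 2 * r).
  apply: mulr_ge0; first exact: mulr_ge0 A0 (ltW r0).
  by rewrite addr_ge0 ?pi_ge0// mulr_ge0// ltW.
have [d1 d10 hd1] := sqrt_small C0 d8.
pose a := Num.min d1 r.
have a0 : 0 < a by rewrite lt_min d10.
have ar : a <= r by rewrite ge_min lexx orbT.
have {hd1} h1 : A * r * (pi + 2 * r) * Num.sqrt a <= delta / 8.
  by apply: hd1; [exact: ltW|rewrite ge_min lexx].
have [N N0 hN] := exp_tail_small a0 (sqr_ge0 L) d8.
have tau0 : 0 < delta / (8 * N) by rewrite divr_gt0// mulr_gt0.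
have [kap k0 hk] := fpower_continuation N0 tau0.
exists kap => // F FB [Z [mZ Z0 hol]] big; rewrite leNgt; apply/negP => small.
have {}hk := hk F FB small.
have [Fi FL] := energy_ball_integ FB; have Fo := energy_ball_out FB.
have [mF F2 Fout _] := FB.
have low : pi / 4 * \int[mu]_x (F x ^+ 2) - A * r * (pi + 2 * r) * Num.sqrt a
    <= poisson_form F a.
  apply: (@poisson_form_ge R F a r a0 r0 Fi F2 Fout Z A _ mZ Z0 A0 hol).
  move=> x Fx.
  have [Dx|/Fout/eqP] := pselect (`]- r, r[%classic x); last by rewrite (negbTE Fx).
  move: Dx; rewrite /= in_itv/= => /andP[x1 x2].
  have at1 t : 1 <= t -> pi / 4 <= atan t :> R.
    by move=> t1; rewrite -atan1 le_atan.
  have at0 t : 0 <= t -> 0 <= atan t :> R.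
    by move=> t1; rewrite -atan0 le_atan.
  have [x0|x0] := leP 0 x.
    rewrite ler_wpDl ?at0 ?divr_ge0 ?(ltW a0) ?subr_ge0 ?(ltW x2)//.
    by rewrite at1// ler_pdivlMr// mul1r; lra.
  have rx : 0 <= r + x by lra.
  rewrite ler_wpDr ?at0 ?divr_ge0 ?(ltW a0)//.
  by rewrite at1// ler_pdivlMr// mul1r; lra.
have E := poisson_energy Fi Fo a0 N0.
rewrite -/(poisson_form F a) in E.
have Fc := continuous_fpower Fi Fo.
have up : \int[mu]_w (expR (- a * w) * \1_`[0, N] w * fpower F w) <= delta / 8.
  have -> : delta / 8 = \int[mu]_w (delta / (8 * N) * \1_`[0, N] w).
    rewrite RintZ; last exact: integ_itv.
    by rewrite Rint_indic_itv// subr0; field; rewrite gt_eqF.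
  apply: Rint_le.
  - have := @integ_window R (fun w => expR (- a * w) * fpower F w) 0 N true false.
    rewrite (_ : (fun w => \1_`[0, N] w * (expR (- a * w) * fpower F w)) =
      (fun w => expR (- a * w) * \1_`[0, N] w * fpower F w)).
      by apply => w; apply: cvgM; [exact: continuous_expM|exact: Fc].
    by apply/funext => w; rewrite mulrA [X in X * _]mulrC.
  - exact/integZ/integ_itv.
  - move=> w; rewrite indicE; have [|_] := boolP (w \in _); last first.
      by rewrite !mulr0 mul0r.
    rewrite inE /= in_itv/= => wN; have /andP[w1 _] := wN; rewrite !mulr1.
    rewrite (le_trans _ (hk w wN))// ler_piMl ?fpower_ge0//.
    by rewrite -expR0 ler_expR mulNr oppr_le0 mulr_ge0// ltW.
have err : 2 / a * expR (- a * N) * (\int[mu]_z `|F z|) ^+ 2 <= delta / 8.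
  rewrite (le_trans _ hN)// ler_wpM2l//.
    by rewrite mulr_ge0 ?expR_ge0// divr_ge0// ltW.
  by rewrite lerXn2r// nnegrE ?(ltW L0)// Rint_ge0.
have pi2 : 1 / 2 * delta <= pi / 4 * \int[mu]_x (F x ^+ 2).
  rewrite ler_pM ?(ltW d0) ?(ltW big)//; have := @pi_ge2 R; lra.
move: E; rewrite ler_norml => /andP[E _].
lra.
Qed.

End Continuation.

(** * The stability estimates *)

Section Difference.
Context {R : realType}.
Local Notation mu := (@lebesgue_measure R).

Lemma H1_difference (r M : R) (s t : R -> R) :
  let D : set (measurableTypeR R) := `]- r, r[%classic in
  let h := weak_deriv D s \- weak_deriv D t in
  0 < r -> 0 < M -> in_H1 D s -> in_H1 D t -> H1norm D s <= M -> H1norm D t <= M ->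
  [/\ in_L2 D (s \- t), in_L2 D h, weak_derivative D (s \- t) h,
      \int[mu]_x (((s \- t) \_ D) x ^+ 2) <= 4 * M ^+ 2 &
      \int[mu]_x ((h \_ D) x ^+ 2) <= 4 * M ^+ 2].
Proof.
move=> D h r0 M0 sH tH sM tM.
have [sL _] := sH; have [tL _] := tH.
have [dsL dsW s1 s2] := H1norm_le sH M0 sM.
have [dtL dtW t1 t2] := H1norm_le tH M0 tM.
have stL := in_L2B sL tL; have hL : in_L2 D h by exact: in_L2B.
have bound (f g : R -> R) : in_L2 D f -> in_L2 D g -> in_L2 D (f \- g) ->
    \int[mu]_x ((f \_ D) x ^+ 2) <= M ^+ 2 -> \int[mu]_x ((g \_ D) x ^+ 2) <= M ^+ 2 ->
    \int[mu]_x (((f \- g) \_ D) x ^+ 2) <= 4 * M ^+ 2.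
  move=> fL gL fgL f1 g1; have := in_L2_sqr fgL; rewrite patchB => i.
  have := Rint_sqrB_le (in_L2_sqr fL) (in_L2_sqr gL) i.
  have -> : 4 * M ^+ 2 = 2 * (M ^+ 2 + M ^+ 2) by ring.
  by move=> /le_trans; apply; rewrite ler_wpM2l// lerD.
split.
- exact: stL.
- exact: hL.
- exact: (weak_derivativeB r0 sL tL dsL dtL dsW dtW).
- exact: (bound s t sL tL stL s1 t1).
- exact: (bound _ _ dsL dtL hL s2 t2).
Qed.

Lemma Hnorm_sqr_diff (r u v : R) (s t : R -> R) :
  let D : set (measurableTypeR R) := `]- r, r[%classic in
  0 < r -> 0 <= u -> in_L2 D s -> in_L2 D t ->
  4 * Hnorm `]u, v[%classic (Gamma (s \_ D) \- Gamma (t \_ D)) ^+ 2 =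
  \int[mu]_w (\1_`]u, v[ w * fpower ((s \- t) \_ D) w).
Proof.
move=> D r0 u0 sL tL.
have outD (f : R -> R) z : ~ D z -> (f \_ D) z = 0 by move=> nD; rewrite patchE memNset.
have [si _] := sqr_integ r0 (in_L2_measurable sL) (outD s) (in_L2_sqr sL).
have [ti _] := sqr_integ r0 (in_L2_measurable tL) (outD t) (in_L2_sqr tL).
have stL := in_L2B sL tL.
have [sti _] := sqr_integ r0 (in_L2_measurable stL) (outD _) (in_L2_sqr stL).
rewrite Hnorm_sqr// -patchB -RintZ.
  by apply: Rint_eq => w; field.
have cF : continuous (fpower ((s \- t) \_ D)).
  apply: (@continuous_fpower R _ r sti) => x rx; apply: outD.
  rewrite /D /= in_itv/= => /andP[x1 x2].
  by move: rx; rewrite ltr_normr => /orP[] ?; lra.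
have := integZ 4^-1 (@integ_window R _ u v false true cF).
rewrite (_ : (fun x => 4^-1 * _) = (fun w => \1_`]u, v[ w * (fpower ((s \- t) \_ D) w / 4)))//.
by apply/funext => w; rewrite mulrCA mulrC; ring.
Qed.

End Difference.

Theorem proposition12 (R : realType) (r kmax M eps : R)
    (r_gt0 : 0 < r) (kmax_gt_pi : pi < kmax) (M_gt0 : 0 < M)
    (eps_gt0 : 0 < eps) (eps_lt1 : eps < 1) :
  let D : set R := (`](- r), r[)%classic in
  let K1 : R := kmax + Num.sqrt (kmax ^+ 2 - pi ^+ 2) in
  let I0 : set R := (`]0, 2 * kmax[)%classic in
  let I1 : set R := (`]pi, K1[)%classic in
  exists xi : R,
  forall s0 s0app s1 s1app : R -> R,
    in_H1 D s0 -> in_H1 D s0app -> in_H1 D s1 -> in_H1 D s1app ->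
    H1norm D s0 <= M -> H1norm D s0app <= M ->
    H1norm D s1 <= M -> H1norm D s1app <= M ->
    let d0 := Gamma (s0 \_ D) in
    let d0app := Gamma (s0app \_ D) in
    let d1 := Gamma (s1 \_ D) in
    let d1app := Gamma (s1app \_ D) in
    (* The boundary condition (zero extension of s0 - s0app in H^1(R)) is needed:
       without it the first estimate fails for large kmax. *)
    (in_H1 setT ((s0 \- s0app) \_ D) ->
      L2norm D (s0 \- s0app) ^+ 2 <=
        4 / pi * Hnorm I0 (d0 \- d0app) ^+ 2 + 2 * pi / kmax ^+ 2 * M ^+ 2) /\
    L2norm D (s1 \- s1app) ^+ 2 <=
      xi * Hnorm I1 (d1 \- d1app) `^ (2 - 2 * eps)
      + 4 / pi * Hnorm I1 (d1 \- d1app) ^+ 2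
      + 8 * pi / K1 ^+ 2 * M ^+ 2.
Proof.
move=> D K1 I0 I1.
have pi0 : 0 < pi :> R by exact: pi_gt0.
have pi2 : 2 <= pi :> R by exact: pi_ge2.
have k0 : 0 < kmax by exact: lt_trans kmax_gt_pi.
have piK : pi < K1 by rewrite /K1 ltr_wpDr// sqrtr_ge0.
have K0 : 0 < K1 by exact: lt_trans piK.
(* Below this size of the square norm the last term alone is large enough. *)
pose delta := 8 * pi / K1 ^+ 2 * M ^+ 2.
have delta0 : 0 < delta by rewrite mulr_gt0 ?exprn_gt0// divr_gt0 ?exprn_gt0// mulr_gt0.
have M2 : 0 <= 4 * M ^+ 2 by rewrite mulr_ge0// sqr_ge0.
have A0 : 0 <= ((1 + 4 * M ^+ 2) / 2) ^+ 2 by exact: sqr_ge0.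
have [kap kap0 hkap] := band_energy_lower_bound r_gt0 M2 piK A0 delta0.
pose c := Num.sqrt (kap / 4).
have c0 : 0 < c by rewrite sqrtr_gt0 divr_gt0.
have e2 : 0 <= 2 - 2 * eps by lra.
(* Above [delta] the norm in the band is at least [c], while the square norm is at
   most 4 M^2. *)
exists (4 * M ^+ 2 / c `^ (2 - 2 * eps)) => s0 t0 s1 t1 s0H t0H s1H t1H s0M t0M s1M t1M /=.
split.
  have [stL hL wd b1 b2] := H1_difference r_gt0 M_gt0 s0H t0H s0M t0M.
  move=> [_ [g [gL wdT]]].
  have W0 : 0 < 2 * kmax by rewrite mulr_gt0.
  have E := energy_estimate r_gt0 W0 stL hL gL wd wdT.
  have [s0L _] := s0H; have [t0L _] := t0H.
  set Hn := Hnorm I0 _.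
  have HE : 4 * Hn ^+ 2 = _ := Hnorm_sqr_diff (2 * kmax) r_gt0 (lexx 0) s0L t0L.
  rewrite -HE in E.
  rewrite L2norm_sqr// -(ler_pM2l pi0) (le_trans E)//.
  rewrite mulrDr; apply: lerD.
    have p0 : pi != 0 :> R by rewrite gt_eqF.
    by move: p0; move: (pi : R) => q q0; rewrite le_eqVlt; apply/orP; left;
      apply/eqP; field.
  have P0 : 0 <= pi / (2 * kmax) ^+ 2 by rewrite divr_ge0 ?sqr_ge0// ltW.
  rewrite (le_trans (ler_wpM2l P0 b2))//.
  have -> : pi / (2 * kmax) ^+ 2 * (4 * M ^+ 2) = pi * (1 / kmax ^+ 2 * M ^+ 2).
    by field; rewrite gt_eqF.
  have pi1 : 1 <= 2 * pi :> R by move: pi2; clear; lra.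
  by rewrite ler_pM2l// ler_wpM2r ?sqr_ge0// ler_wpM2r ?invr_ge0 ?sqr_ge0.
have [stL hL wd b1 b2] := H1_difference r_gt0 M_gt0 s1H t1H s1M t1M.
have [s1L _] := s1H; have [t1L _] := t1H.
set Hn := Hnorm I1 _.
have Hn0 : 0 <= Hn by exact: sqrtr_ge0.
have HE : 4 * Hn ^+ 2 = _ := Hnorm_sqr_diff K1 r_gt0 (ltW pi0) s1L t1L.
rewrite L2norm_sqr//.
have rest : 0 <= 4 / pi * Hn ^+ 2 by rewrite mulr_ge0 ?sqr_ge0// divr_ge0// ltW.
have cp : 0 < c `^ (2 - 2 * eps) by exact: powR_gt0.
have [small|big] := leP (\int[lebesgue_measure]_x (((s1 \- t1) \_ D) x ^+ 2)) delta.
  rewrite -/delta (le_trans small)// lerDr addr_ge0//.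
  by rewrite mulr_ge0 ?powR_ge0// divr_ge0// ltW.
have outD (f : R -> R) z : ~ D z -> (f \_ D) z = 0 by move=> nD; rewrite patchE memNset.
have ball : energy_ball r (4 * M ^+ 2) ((s1 \- t1) \_ D).
  by split; [exact: in_L2_measurable|exact: in_L2_sqr|exact: outD|].
have [sti _] := sqr_integ r_gt0 (in_L2_measurable stL) (outD _) (in_L2_sqr stL).
have [N [mN N0 hol]] := weak_derivative_holder wd (@subset_refl _ _) sti
  (in_L2_measurable hL) (in_L2_sqr hL).
have := hkap _ ball _ big.
rewrite -HE => hb.
have {}hb : kap <= 4 * Hn ^+ 2.
  apply: hb; exists N; split=> // x y Dx Dy Nx Ny.
  rewrite (le_trans (hol x y Dx Dy Nx Ny))// ler_wpM2r//.
  rewrite lerXn2r ?nnegrE ?divr_ge0 ?addr_ge0//.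
    by apply: Rint_ge0 => z; exact: sqr_ge0.
  by rewrite ler_pM2r ?invr_gt0// lerD2l.
have cH : c <= Hn.
  have q4 : kap / 4 <= Hn ^+ 2 by move: hb; clear; lra.
  by rewrite -(ger0_norm Hn0) -sqrtr_sqr; exact: ler_wsqrtr.
have pw : c `^ (2 - 2 * eps) <= Hn `^ (2 - 2 * eps).
  by rewrite ge0_ler_powR// nnegrE// ltW.
have main : 4 * M ^+ 2 <= 4 * M ^+ 2 / c `^ (2 - 2 * eps) * Hn `^ (2 - 2 * eps).
  by rewrite mulrAC ler_pdivlMr// ler_wpM2l.
apply: (le_trans b1); apply: (le_trans main).
rewrite -[leRHS]addrA -/delta lerDl; exact: addr_ge0 rest (ltW delta0).
Qed.
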